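(* Let $D$ be a real symmetric nonnegative definite $n\times n$ matrix. For $z,\zeta\in\mathbb R^n$ and $t>0$ let $$\mathscr M(z,\zeta,t)=(4\pi t)^{-\frac n2}\sqrt{\det j(2tD)}\;\exp\Big\{-\frac1{4t}\Big(\langle j(2tD)\cosh(2tD)\,z,z\rangle+\langle j(2tD)\cosh(2tD)\,\zeta,\zeta\rangle-2\langle j(2tD)\,z,\zeta\rangle\Big)\Big\}.$$ Then for any $v_0\in C(\mathbb R^n)$ such that $e^{-\frac12\langle Dz,z\rangle}v_0(z)\in L^\infty(\mathbb R^n)$, the function $$v(z,t)=\int_{\mathbb R^n}\mathscr M(z,\zeta,t)\,v_0(\zeta)\,d\zeta$$ is a solution of the Cauchy problem $$\begin{cases}\Delta_zv-|Dz|^2v-\partial_tv=0,& z\in\mathbb R^n,\ t>0,\\ v(z,0)=v_0(z),& z\in\mathbb R^n.\end{cases}$$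
   Context: $j:\mathbb R\to\mathbb R$ is the real analytic function $j(\tau)=\tau/\sinh\tau$ (with $j(0)=1$). For a real symmetric matrix $C$, $j(C)$ and $\cosh C$ are defined through the functional calculus (equivalently $\cosh C=\sum_{k\ge0}C^{2k}/(2k)!$ and $j(C)=\big(\sum_{k\ge0}C^{2k}/(2k+1)!\big)^{-1}$). The initial condition is understood as $v(z,t)\to v_0(z)$ pointwise as $t\to0^+$. *)

(* Defs.v *)
From HB Require Import structures.
From mathcomp Require Export all_boot all_order all_algebra.
From mathcomp Require Export all_classical all_reals all_analysis.
Import Order.TTheory GRing.Theory Num.Theory.
Export numFieldNormedType.Exports.

Set Implicit Arguments.
Unset Strict Implicit.
Unset Printing Implicit Defensive.

Local Open Scope classical_set_scope.
Local Open Scope ring_scope.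

(* R^n is the type 'cV[R]_n of column vectors, so that D z is D *m z. *)

(* The sigma-algebra on R^n generated by the n coordinate functions, i.e. the
   Borel sigma-algebra (compare the library's instance on n.-tuple T). *)
Section measurable_cV.
Context (R : realType) (n : nat).

Let coor : 'I_n -> 'cV[R]_n -> measurableTypeR R := fun i z => z i ord0.

Let cV_set0 : g_sigma_preimage coor set0.
Proof. exact: sigma_algebra0. Qed.

Let cV_setC A : g_sigma_preimage coor A -> g_sigma_preimage coor (~` A).
Proof. exact: sigma_algebraC. Qed.

Let cV_bigcup (F : _^nat) : (forall i, g_sigma_preimage coor (F i)) ->
  g_sigma_preimage coor (\bigcup_i (F i)).
Proof. exact: sigma_algebra_bigcup. Qed.

HB.instance Definition _ := @isMeasurable.Build default_measure_display
  'cV[R]_n (g_sigma_preimage coor) cV_set0 cV_setC cV_bigcup.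

Lemma measurable_coor (i : 'I_n) :
  measurable_fun [set: 'cV[R]_n] (fun z => z i ord0 : measurableTypeR R).
Proof.
move=> _ Y mY; rewrite setTI; apply: sub_sigma_algebra => /=.
rewrite -bigcup_seq/=; exists i => /=; first by rewrite mem_index_enum.
by exists Y => //; rewrite setTI.
Qed.

Lemma measurable_box (A : 'I_n -> set (measurableTypeR R)) :
  (forall i, measurable (A i)) ->
  measurable [set z : 'cV[R]_n | forall i, A i (z i ord0)].
Proof.
move=> mA; rewrite (_ : mkset _ =
    \big[setI/setT]_(i < n) [set z : 'cV[R]_n | A i (z i ord0)]).
  apply: bigsetI_measurable => i _.
  by rewrite -[X in measurable X]setTI; exact: measurable_coor.
rewrite -bigcap_seq; apply/seteqP; split=> z /= Az i.
  by move=> _; exact: Az.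
by apply: Az; rewrite /= mem_index_enum.
Qed.

Lemma measurable_fun_coorP d (T : measurableType d) (f : T -> 'cV[R]_n) :
  (forall i, measurable_fun [set: T] (fun x => f x i ord0 : measurableTypeR R)) ->
  measurable_fun [set: T] f.
Proof.
move=> mf; suff H : measurable `<=` [set A | measurable (f @^-1` A)].
  by move=> _ A /H; rewrite setTI.
apply: smallest_sub.
  split => [|A|F mF] /=.
  - by rewrite preimage_set0.
  - by rewrite setTD preimage_setC; exact: measurableC.
  - by rewrite preimage_bigcup; exact: bigcupT_measurable.
move=> A; rewrite -bigcup_seq/= => -[i _ [B mB <-]].
by rewrite setTI -comp_preimage -[_ @^-1` _]setTI; exact: mf.
Qed.

End measurable_cV.

Section lebesgue_cV.
Context (R : realType).

Definition ccons n (p : measurableTypeR R * 'cV[R]_n) : 'cV[R]_n.+1 :=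
  col_mx (p.1%:M : 'cV[R]_1) p.2.

Lemma ccons0 n p : @ccons n p ord0 ord0 = p.1.
Proof.
have /esym := col_mxEu (p.1%:M : 'cV[R]_1) p.2 ord0 ord0.
rewrite mxE eqxx mulr1n => ->; rewrite /ccons.
by congr (fun_of_matrix _ _ _); exact/val_inj.
Qed.

Lemma cconsS n p i : @ccons n p (lift ord0 i) ord0 = p.2 i ord0.
Proof.
have <- := col_mxEd (p.1%:M : 'cV[R]_1) p.2 i ord0.
by rewrite /ccons; congr (fun_of_matrix _ _ _); exact/val_inj.
Qed.

Lemma measurable_ccons n : measurable_fun [set: _] (@ccons n).
Proof.
apply: measurable_fun_coorP => i; have [j ->|->] := unliftP ord0 i.
- under eq_fun do rewrite cconsS.
  exact: measurableT_comp (measurable_coor j) measurable_snd.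
- under eq_fun do rewrite ccons0.
  exact: measurable_fst.
Qed.

HB.instance Definition _ n :=
  isMeasurableFun.Build _ _ _ _ (@ccons n) (@measurable_ccons n).

Section lebesgue_ccons.
Context n (mu : {sigma_finite_measure set 'cV[R]_n -> \bar R}).

Let leb : {sigma_finite_measure set (measurableTypeR R) -> \bar R} :=
  @lebesgue_measure R.

Definition lebesgue_ccons : set 'cV[R]_n.+1 -> \bar R :=
  pushforward (leb \x mu)%E (@ccons n).

Let lebesgue_ccons0 : lebesgue_ccons set0 = 0%E.
Proof. exact: measure0. Qed.

Let lebesgue_ccons_ge0 A : (0 <= lebesgue_ccons A)%E.
Proof. exact: measure_ge0. Qed.

Let lebesgue_ccons_sigma_additive : semi_sigma_additive lebesgue_ccons.
Proof. exact: measure_semi_sigma_additive. Qed.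

HB.instance Definition _ := isMeasure.Build _ _ _ lebesgue_ccons
  lebesgue_ccons0 lebesgue_ccons_ge0 lebesgue_ccons_sigma_additive.

Lemma lebesgue_cconsE (A : set (measurableTypeR R)) (B : set 'cV[R]_n) :
  measurable A -> measurable B ->
  lebesgue_ccons [set z : 'cV[R]_n.+1 | A (z ord0 ord0) /\ B (\col_i z (lift ord0 i) ord0)] =
  (leb A * mu B)%E.
Proof.
move=> mA mB; rewrite -product_measure1E//; congr (product_measure1 _ _ _).
apply/seteqP; split=> -[x z] /=; rewrite ccons0 (_ : \col_i _ = z)//;
  by apply/colP => i; rewrite mxE cconsS.
Qed.

Lemma measurable_tailP (A : set (measurableTypeR R)) (B : set 'cV[R]_n) :
  measurable A -> measurable B ->
  measurable [set z : 'cV[R]_n.+1 |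
    A (z ord0 ord0) /\ B (\col_i z (lift ord0 i) ord0)].
Proof.
move=> mA mB; apply: measurableI.
- rewrite -[X in measurable X]setTI.
  exact: (measurable_coor (ord0 : 'I_n.+1)).
- have : measurable_fun setT
    (fun z : 'cV[R]_n.+1 => \col_i z (lift ord0 i) ord0).
    apply: measurable_fun_coorP => i; under eq_fun do rewrite mxE.
    exact: measurable_coor.
  by move=> mtl; rewrite -[X in measurable X]setTI; exact: mtl.
Qed.

Let lebesgue_ccons_sigma_finite : sigma_finite setT lebesgue_ccons.
Proof.
have /sigma_finiteP[F [TF ndF Foo]] := sigma_finiteT leb.
have /sigma_finiteP[G [TG ndG Goo]] := sigma_finiteT mu.
exists (fun k => [set z : 'cV[R]_n.+1 | F k (z ord0 ord0) /\
  G k (\col_i z (lift ord0 i) ord0)]).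
  apply/seteqP; split=> // z _.
  have : setT (z ord0 ord0) by [].
  rewrite TF => -[k _ Fk].
  have : setT (\col_i z (lift ord0 i) ord0 : 'cV[R]_n) by [].
  rewrite TG => -[l _ Gl].
  exists (maxn k l) => //; split.
  - by move: Fk; apply/subsetPset/ndF/leq_maxl.
  - by move: Gl; apply/subsetPset/ndG/leq_maxr.
move=> k; have [mF Fk] := Foo k; have [mG Gk] := Goo k.
split; first exact: measurable_tailP.
by rewrite lebesgue_cconsE// lte_mul_pinfty// ge0_fin_numE.
Qed.

HB.instance Definition _ := Measure_isSigmaFinite.Build _ _ _ lebesgue_ccons
  lebesgue_ccons_sigma_finite.

End lebesgue_ccons.

(* Lebesgue measure on R^n, as the image of the product measure on R * R^(n-1);
   see lebesgue_cV_box for its values on boxes. *)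
Fixpoint lebesgue_cV n : {sigma_finite_measure set 'cV[R]_n -> \bar R} :=
  if n is m.+1 then lebesgue_ccons (lebesgue_cV m) else \d_(0 : 'cV[R]_0).

Lemma lebesgue_cV_box n (A : 'I_n -> set (measurableTypeR R)) :
  (forall i, measurable (A i)) ->
  lebesgue_cV n [set z | forall i, A i (z i ord0)] =
  (\prod_(i < n) lebesgue_measure (A i))%E.
Proof.
elim: n A => [|n IH] A mA /=.
  by rewrite big_ord0 diracE mem_set//= => -[].
rewrite big_ord_recl -IH// -lebesgue_cconsE//; last first.
  exact: (measurable_box (A := fun i => A (lift ord0 i))).
congr (lebesgue_ccons _ _); apply/seteqP; split=> z /=.
  by move=> Az; split=> [|i]; [exact: Az|rewrite mxE; exact: Az].
by move=> [A0 AS] i; have [j ->|->//] := unliftP ord0 i; have := AS j; rewrite mxE.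
Qed.

End lebesgue_cV.

Section functional_calculus.
Context (R : realType).

Definition sinh (x : R) : R := (expR x - expR (- x)) / 2.
Definition cosh (x : R) : R := (expR x + expR (- x)) / 2.
Definition jfun (x : R) : R := if x == 0 then 1 else x / sinh x.

Context (n : nat).

(* P diagonalizes C in an orthonormal basis, with eigenvalues d. *)
Definition orthodiag (C P : 'M[R]_n) (d : 'rV[R]_n) :=
  P *m P^T = 1%:M /\ C = P^T *m diag_mx d *m P.

(* f(C) for a symmetric matrix C; the value does not depend on the chosen
   diagonalization, see mxfunE (and is 0 if C is not symmetric). *)
Definition mxfun (f : R -> R) (C : 'M[R]_n) : 'M[R]_n :=
  xget 0 [set M | exists P d,
    orthodiag C P d /\ M = P^T *m diag_mx (map_mx f d) *m P].

Lemma mxfunE f C P d :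
  orthodiag C P d -> mxfun f C = P^T *m diag_mx (map_mx f d) *m P.
Proof.
move=> CPd; rewrite /mxfun; case: xgetP => [M _ [Q [e [CQe ->]]]|/(_ _)]; last first.
  by move=> /(_ (P^T *m diag_mx (map_mx f d) *m P)) []; exists P, d.
case: CPd CQe => [PPT CE] [QQT CE'].
have PTP := mulmx1C PPT; have QTQ := mulmx1C QQT.
have WE : (Q *m P^T) *m diag_mx d = diag_mx e *m (Q *m P^T).
  transitivity (Q *m C *m P^T).
    by rewrite CE !mulmxA -[RHS]mulmxA PPT mulmx1.
  by rewrite CE' !mulmxA QQT mul1mx.
have intertw (W : 'M[R]_n) : W *m diag_mx d = diag_mx e *m W ->
    W *m diag_mx (map_mx f d) = diag_mx (map_mx f e) *m W.
  move=> /matrixP WdeW; apply/matrixP => i j; move: (WdeW i j).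
  rewrite !mul_mx_diag !mul_diag_mx !mxE => E.
  have [->|W0] := eqVneq (W i j) 0; first by rewrite mul0r mulr0.
  by move: E; rewrite mulrC => /(mulIf W0) ->; exact: mulrC.
have := congr1 (fun X => Q^T *m X *m P) (intertw _ WE).
rewrite !mulmxA QTQ mul1mx => ->.
by rewrite -!mulmxA PTP mulmx1.
Qed.

End functional_calculus.

Section cauchy_problem.
Context (R : realType) (n : nat).
Implicit Types (D : 'M[R]_n) (z zeta : 'cV[R]_n) (t : R).
Implicit Types (f : 'cV[R]_n -> R) (v : 'cV[R]_n -> R -> R).

(* The Euclidean inner product. The norm `|z| of the library on 'cV[R]_n is the
   sup norm, hence the Euclidean |z|^2 is always written dotp z z. *)
Definition dotp z zeta : R := \sum_i z i ord0 * zeta i ord0.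

Definition nonneg_definite D := forall z, 0 <= dotp (D *m z) z.

Definition mehler D z zeta t : R :=
  let J := mxfun (@jfun R) ((2 * t) *: D) in
  let C := mxfun (@cosh R) ((2 * t) *: D) in
  (4 * pi * t) `^ (- (n%:R / 2)) * Num.sqrt (\det J) *
  expR (- (1 / (4 * t)) *
    (dotp (J *m C *m z) z + dotp (J *m C *m zeta) zeta
     - 2 * dotp (J *m z) zeta)).

Definition mehler_integral D (v0 : 'cV[R]_n -> R) z t : R :=
  \int[lebesgue_cV R n]_zeta (mehler D z zeta t * v0 zeta).

Definition partial (i : 'I_n) f z : R := 'D_(delta_mx i ord0) f z.

Definition laplacian f z : R := \sum_i partial i (partial i f) z.

(* Joint continuity of g on the open half space { t > 0 } *)
Definition continuous_half_space (g : 'cV[R]_n -> R -> R) :=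
  forall p : 'cV[R]_n * R, 0 < p.2 -> {for p, continuous (fun q => g q.1 q.2)}.

(* v is of class C^2 in z and C^1 in t on { t > 0 }: the partial derivatives
   exist and are jointly continuous. *)
Definition class_C21 v :=
  [/\ forall z t, 0 < t ->
        [/\ derivable (v z) t 1,
            forall i : 'I_n, derivable (v^~ t) z (delta_mx i ord0) &
            forall i j : 'I_n,
              derivable (partial i (v^~ t)) z (delta_mx j ord0)],
      continuous_half_space v,
      continuous_half_space (fun z t => 'D_1 (v z) t),
      forall i, continuous_half_space (fun z t => partial i (v^~ t) z) &
      forall i j,
        continuous_half_space (fun z t => partial j (partial i (v^~ t)) z)].

Definition classical_solution D (v0 : 'cV[R]_n -> R) v :=
  [/\ class_C21 v,
      forall z t, 0 < t ->
        laplacian (v^~ t) z - dotp (D *m z) (D *m z) * v z t - 'D_1 (v z) t = 0 &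
      forall z, v z t @[t --> 0^'+] --> v0 z].

End cauchy_problem.

(* Main.v *)
Require Import Defs.
From mathcomp Require Import complex measurable_realfun ess_sup_inf.
From mathcomp Require Import lebesgue_integral_under ring lra.

(* Diagonalize D = P^T diag(d) P and write y = P z, eta = P zeta. The kernel is
   then the product over k of
     sqrt(c/pi) exp(- (b (y_k^2 + eta_k^2) - 2 c y_k eta_k)),
   where b = (d_k/2) coth(2 t d_k) and c = d_k / (2 sinh(2 t d_k)), both read as
   1/(4t) when d_k = 0. The relations b' = - 4 c^2, c' = - 4 b c and
   b^2 - c^2 = d_k^2/4 give the equation for the kernel. As b > d_k/2, the
   product of the kernel and v0 decays like a Gaussian in zeta, locally uniformly
   in (z, t), so that one may differentiate under the integral sign. For the
   initial condition, substitute zeta = z + sqrt(4t) w: as t -> 0 the rescaled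
   kernel tends to the standard Gaussian density, with a Gaussian bound.
   The only change of variables is thus a translation and dilation; since
   |P zeta| = |zeta|, the rotation invariance of the Lebesgue measure is never
   needed. *)

(** Strictness of b > d_k/2 comes from c > 0 in b^2 = c^2 + d_k^2/4. This margin is all that beats
    data of size exp(<Dz,z>/2), and it tends to 0 as t grows, so domination can only be local in (z,
    t). Space and time are handled together: (z, t) is a point [p], and every derivative is a
    derivative at 0 along a line through [p]. Differentiating the kernel multiplies it by a
    polynomial in zeta whose coefficients are continuous in [p]. The class [subgaussian] contains
    these factors and is closed under sums and products, so one lemma on differentiation under the
    integral, applied twice, gives all derivatives required by [class_C21], and one lemma gives
    their joint continuity. Membership in L^oo bounds the weighted data only almost everywhere.
    Continuity of [v0] turns this into a bound at every point, and only its constant [K] is carried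
    through the estimates. *)

Import Order.TTheory GRing.Theory Num.Theory.
Local Open Scope classical_set_scope.
Local Open Scope ring_scope.

Set Implicit Arguments.
Unset Strict Implicit.
Unset Printing Implicit Defensive.

(** * The spectral theorem for real symmetric matrices *)

Section spectral.
Context (R : realType).

Lemma row_sqr_eq0 n (w : 'rV[R]_n) : w *m w^T = 0 -> w = 0.
Proof.
move=> /matrixP /(_ 0 0); rewrite !mxE => s0.
apply/rowP => j; rewrite [RHS]mxE; apply/eqP; rewrite -sqrf_eq0.
have /psumr_eq0P : \sum_j w 0 j ^+ 2 = 0.
  by rewrite -[RHS]s0; apply: eq_bigr => i _; rewrite mxE expr2.
by move=> -> // i _; exact: sqr_ge0.
Qed.

(** A complex eigenvector x + iy exists because [R[i]] is algebraically closed. By symmetry x A y^T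
    equals y A x^T; expanding both sides leaves Im a (|x|^2 + |y|^2) = 0. Hence the eigenvalue is
    real, and whichever of x, y is nonzero is a real eigenvector. *)
Lemma symmetric_eigenvalue n (A : 'M[R]_n.+1) : A^T = A ->
  exists a, eigenvalue A a.
Proof.
move=> AT.
have [a /eigenvalueP[v vA v0]] :=
  @eigenvalue_closed R[i] n.+1 (map_mx (real_complex R) A) isT.
pose x := map_mx (@complex.Re R) v; pose y := map_mx (@complex.Im R) v.
have xA : x *m A = complex.Re a *: x - complex.Im a *: y.
  apply/rowP => j; move/rowP : (vA) => /(_ j) /(congr1 (@complex.Re R)).
  rewrite !mxE raddf_sum/= => E; rewrite [RHS](_ : _ = complex.Re (a * v 0 j)).
    rewrite -E; apply: eq_bigr => i _; rewrite !mxE.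
    by case: (v 0 i) => p q /=; rewrite mulr0 subr0.
  by case: (a) => a1 b1; case: (v 0 j) => p q /=.
have yA : y *m A = complex.Re a *: y + complex.Im a *: x.
  apply/rowP => j; move/rowP : (vA) => /(_ j) /(congr1 (@complex.Im R)).
  rewrite !mxE raddf_sum/= => E; rewrite [RHS](_ : _ = complex.Im (a * v 0 j)).
    rewrite -E; apply: eq_bigr => i _; rewrite !mxE.
    by case: (v 0 i) => p q /=; rewrite mulr0 add0r.
  by case: (a) => a1 b1; case: (v 0 j) => p q /=.
have : x *m A *m y^T = (y *m A *m x^T)^T.
  by rewrite !trmx_mul trmxK AT mulmxA.
rewrite xA yA mulmxBl mulmxDl linearD/= -!scalemxAl !linearZ/=.
rewrite !trmx_mul !trmxK => /addrI E.
exists (complex.Re a); apply/eigenvalueP.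
have a0 : complex.Im a = 0.
  apply/eqP; apply: contraNT v0 => b0.
  have xy0 : x *m x^T + y *m y^T = 0.
    apply/eqP; move/eqP : E; rewrite eq_sym -subr_eq0 scalerN opprK -scalerDr.
    by rewrite scaler_eq0 (negPf b0).
  have sq (w : 'rV[R]_n.+1) : 0 <= (w *m w^T) 0 0.
    by rewrite mxE sumr_ge0// => i _; rewrite mxE -expr2 sqr_ge0.
  have sq0 (w : 'rV[R]_n.+1) : (w *m w^T) 0 0 = 0 -> w = 0.
    by move=> w0; apply: row_sqr_eq0; rewrite [LHS]mx11_scalar w0 raddf0.
  have : (x *m x^T) 0 0 + (y *m y^T) 0 0 = 0.
    by move/matrixP : xy0 => /(_ 0 0); rewrite !mxE.
  move/eqP; rewrite paddr_eq0 ?sq// => /andP[/eqP/sq0 x0 /eqP/sq0 y0].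
  apply/eqP/rowP => j; move/rowP : x0 => /(_ j); move/rowP : y0 => /(_ j).
  by rewrite !mxE; case: (v 0 j) => p q /= -> ->.
have [x0|x0] := eqVneq x 0; last first.
  by exists x => //; rewrite xA a0 scale0r subr0.
exists y; first by rewrite yA a0 scale0r addr0.
apply: contraNneq v0 => y0.
apply/eqP/rowP => j; move/rowP : x0 => /(_ j); move/rowP : y0 => /(_ j).
by rewrite !mxE; case: (v 0 j) => p q /= -> ->.
Qed.

(* Q is the Householder reflection that exchanges u and the first basis
   vector. *)
Lemma orthogonal_first_row n (u : 'rV[R]_n.+1) : u *m u^T = 1%:M ->
  exists Q : 'M[R]_n.+1, Q *m Q^T = 1%:M /\ row ord0 Q = u.
Proof.
move=> u1; pose e : 'rV[R]_n.+1 := delta_mx 0 0.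
have [ue|ue] := eqVneq u e.
  by exists 1%:M; rewrite trmx1 mulmx1 row1 ue.
pose w := u - e.
have ee : e *m e^T = 1%:M.
  rewrite trmx_delta mul_delta_mx [RHS]mx11_scalar !mxE.
  by apply/matrixP => i j; rewrite !mxE !ord1.
have eu : e *m u^T = (u 0 0)%:M.
  by rewrite -rowE [LHS]mx11_scalar !mxE.
have ue' : u *m e^T = (u 0 0)%:M.
  by rewrite -[LHS]trmxK trmx_mul trmxK eu tr_scalar_mx.
have ew : e *m w^T = (u 0 0 - 1)%:M.
  by rewrite linearB/= mulmxBr eu ee raddfB.
have ww : w *m w^T = (2 * (1 - u 0 0))%:M.
  rewrite linearB/= mulmxBr !mulmxBl u1 ue' eu ee.
  have -> : 2 * (1 - u 0 0) = 1 - u 0 0 - (u 0 0 - 1) by ring.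
  by rewrite !raddfB.
have u01 : 1 - u 0 0 != 0.
  apply: contra ue => /eqP u0.
  have w0 : w = 0.
    by apply: row_sqr_eq0; rewrite ww u0 mulr0 raddf0.
  by rewrite -subr_eq0 -/w w0.
have we : e + w = u by rewrite addrC subrK.
clearbody w.
(* The reflection coefficient 2/|w|^2, since |w|^2 = 2 (1 - u_0). It is defined because u differs
   from e. *)
pose Q := 1%:M - (1 - u 0 0)^-1 *: (w^T *m w).
have QT : Q^T = Q.
  by rewrite /Q linearB/= trmx1 linearZ/= trmx_mul trmxK.
exists Q; split.
  rewrite QT /Q mulmxBl mul1mx mulmxBr mulmx1 -scalemxAl -scalemxAr.
  rewrite mulmxA -(mulmxA w^T) ww mul_mx_scalar -scalemxAl !scalerA.
  have -> : (1 - u 0 0)^-1 * ((1 - u 0 0)^-1 * (2 * (1 - u 0 0))) =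
      2 * (1 - u 0 0)^-1.
    by field.
  by rewrite mulr_natl mulr2n scalerDl opprB addrK subrK.
rewrite rowE -/e /Q mulmxBr mulmx1 -scalemxAr mulmxA ew mul_scalar_mx scalerA.
have -> : (1 - u 0 0)^-1 * (u 0 0 - 1) = -1 by field.
by rewrite scaleN1r opprK.
Qed.

Lemma orthodiag_block n (a : R) (C P : 'M[R]_n) d : orthodiag C P d ->
  orthodiag (block_mx (a%:M : 'M[R]_1) 0 0 C : 'M[R]_(1 + n))
    (block_mx (1%:M : 'M[R]_1) 0 0 P) (row_mx (a%:M : 'M[R]_1) d).
Proof.
move=> [PP CE]; split.
  rewrite tr_block_mx mulmx_block.
  rewrite !(trmx0, mulmx0, mul0mx, addr0, add0r) trmx1 mulmx1 PP.
  by rewrite -scalar_mx_block.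
rewrite CE diag_mx_row tr_block_mx !mulmx_block.
rewrite !(trmx0, mulmx0, mul0mx, addr0, add0r) trmx1 mulmx1 mul1mx.
by congr block_mx; apply/matrixP => i j; rewrite !ord1 !mxE.
Qed.

Lemma orthodiag_conj n (B P Q : 'M[R]_n) d : Q *m Q^T = 1%:M ->
  orthodiag B P d -> orthodiag (Q^T *m B *m Q) (P *m Q) d.
Proof.
move=> QQ [PP ->]; split; last by rewrite trmx_mul !mulmxA.
by rewrite trmx_mul -mulmxA (mulmxA Q) QQ mul1mx.
Qed.

(** Deflation by induction on the size: an orthogonal matrix whose first row is a unit eigenvector
    conjugates A to a matrix with first row a e_0. Symmetry clears the first column as well, and the
    remaining block is symmetric and one size smaller. *)
Lemma symmetric_orthodiag n (A : 'M[R]_n) : A^T = A ->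
  exists P d, orthodiag A P d.
Proof.
elim: n A => [|n IH] A AT.
  by exists 1%:M, 0; split; [rewrite trmx1 mulmx1|rewrite [A]flatmx0 [RHS]flatmx0].
have [a /eigenvalueP[v vA v0]] := symmetric_eigenvalue AT.
have vv_gt0 : 0 < (v *m v^T) 0 0.
  rewrite lt_neqAle; apply/andP; split; last first.
    by rewrite mxE sumr_ge0// => i _; rewrite mxE -expr2 sqr_ge0.
  apply: contra v0 => /eqP v0; apply/eqP/row_sqr_eq0.
  by rewrite [LHS]mx11_scalar -v0 raddf0.
pose u := (Num.sqrt ((v *m v^T) 0 0))^-1 *: v.
have uu : u *m u^T = 1%:M.
  rewrite /u linearZ/= -scalemxAl -scalemxAr scalerA -expr2 exprVn.
  rewrite sqr_sqrtr ?ltW// [X in _ *: X]mx11_scalar scale_scalar_mx.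
  by rewrite mulVf// gt_eqF.
have uA : u *m A = a *: u.
  by rewrite /u -scalemxAl vA !scalerA mulrC.
have [Q [QQ Qu]] := orthogonal_first_row uu.
have QQ' := mulmx1C QQ.
pose B : 'M[R]_(1 + n) := Q *m A *m Q^T.
have BT : B^T = B by rewrite /B !trmx_mul trmxK AT mulmxA.
have B0 : row ord0 B = a *: delta_mx 0 0.
  rewrite /B !row_mul Qu uA -scalemxAl -Qu rowE -mulmxA QQ mulmx1//.
have BA : A = Q^T *m B *m Q.
  by rewrite /B !mulmxA QQ' mul1mx -mulmxA QQ' mulmx1.
clearbody B.
have Ble : B = block_mx a%:M 0 0 (drsubmx B).
  rewrite -[LHS]submxK; congr block_mx.
  - apply/matrixP => i j; rewrite !ord1 !mxE eqxx mulr1n.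
    move/rowP : B0 => /(_ 0); rewrite !mxE eqxx mulr1 => <-.
    by congr (B _ _); exact/val_inj.
  - apply/matrixP => i j; rewrite !ord1 !mxE.
    move/rowP : B0 => /(_ (rshift 1 j)); rewrite !mxE mulr0 => <-.
    by congr (B _ _); exact/val_inj.
  - apply/matrixP => i j; rewrite !ord1 -BT !mxE.
    move/rowP : B0 => /(_ (rshift 1 i)); rewrite !mxE mulr0 => <-.
    by congr (B _ _); exact/val_inj.
have drT : (drsubmx B)^T = drsubmx B by rewrite trmx_drsub BT.
have [P' [d' [PP' E']]] := IH (drsubmx B) drT.
rewrite BA Ble.
do 2 eexists; exact: (orthodiag_conj QQ (orthodiag_block a (conj PP' E'))).
Qed.
End spectral.

(** * Integration on R^n *)

Section affine_substitution_line.
Context (R : realType) (z s : R).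
Local Notation leb := (@lebesgue_measure R).

Definition affine (x : measurableTypeR R) : measurableTypeR R := z + s * x.

Lemma measurable_affine : measurable_fun [set: measurableTypeR R] affine.
Proof. by apply: measurable_funD => //; apply: measurable_funM. Qed.

(** The image of Lebesgue measure under [affine], multiplied by s, gives each interval ]a, b] its
    length, so it is Lebesgue measure by uniqueness. *)
Lemma ge0_integral_affine (f : measurableTypeR R -> \bar R) : 0 < s ->
  measurable_fun [set: measurableTypeR R] f -> (forall x, (0 <= f x)%E) ->
  (s%:E * \int[leb]_x f (z + s * x)%R = \int[leb]_x f x)%E.
Proof.
move=> s0 mf f0.
pose snn : {nonneg R} := NngNum (ltW s0).
pose pf : {measure set (measurableTypeR R) -> \bar R} :=
  measure_function_pushforward__canonical__measure_function_Measure leb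
    measurable_affine.
transitivity (\int[mscale snn pf]_x f x)%E.
  rewrite ge0_integral_mscale//; congr (_ * _)%E.
  by rewrite (ge0_integral_pushforward measurable_affine).
apply: eq_measure_integral => A mA _; symmetry.
apply: lebesgue_measure_unique => // _ [[a b] _ <-] /=.
rewrite /mscale/= /pushforward/=.
have -> : affine @^-1` `]a, b] = `](a - z) / s, (b - z) / s]%classic.
  apply/seteqP; split => x /=; rewrite /affine !in_itv/= ltr_pdivrMr// ler_pdivlMr//;
    by rewrite ltrBlDl lerBrDl (mulrC s).
rewrite [LHS]lebesgue_measure_itv [X in (_ * X)%E]lebesgue_measure_itv/= !lte_fin.
rewrite ltr_pM2r ?invr_gt0// ltrD2r; case: ifP => _; last by rewrite mule0.
rewrite -!EFinD -EFinM; congr EFin.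
by field; rewrite gt_eqF.
Qed.

End affine_substitution_line.

Section lebesgue_cV_integral.
Context (R : realType).
Local Notation leb := (@lebesgue_measure R).

Lemma ge0_integral_cVS n (f : 'cV[R]_n.+1 -> \bar R) :
  measurable_fun [set: 'cV[R]_n.+1] f -> (forall x, (0 <= f x)%E) ->
  (\int[lebesgue_cV R n.+1]_z f z =
   \int[leb]_x \int[lebesgue_cV R n]_y f (ccons (x, y)))%E.
Proof.
move=> mf f0.
rewrite [LHS](ge0_integral_pushforward (@measurable_ccons R n))// preimage_setT.
rewrite (fubini_tonelli1 (f \o @ccons R n))//.
- by apply: measurableT_comp => //; exact: measurable_ccons.
- by move=> x; exact: f0.
Qed.

Lemma ge0_integral_prod_cV n (h : measurableTypeR R -> R) (I : R) :
  measurable_fun [set: measurableTypeR R] h -> (forall x, 0 <= h x) ->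
  (\int[leb]_x (h x)%:E = I%:E)%E ->
  (\int[lebesgue_cV R n]_z (\prod_i h (z i ord0))%:E = (I ^+ n)%:E)%E.
Proof.
move=> mh h0 hI.
have mprod m : measurable_fun [set: 'cV[R]_m]
    (fun z : 'cV[R]_m => (\prod_i h (z i ord0))%:E).
  apply/measurable_EFinP; apply: measurable_prod => i _.
  by apply: measurableT_comp => //; exact: measurable_coor.
elim: n => [|n IH].
  rewrite /= integral_dirac//; last exact: (mprod 0).
  rewrite diracE mem_set// mul1e expr0.
  by rewrite big_ord0.
rewrite ge0_integral_cVS//; last by move=> z; rewrite lee_fin prodr_ge0.
transitivity (\int[leb]_x ((I ^+ n)%:E * (h x)%:E))%E.
  apply: eq_integral => x _; rewrite -IH muleC -ge0_integralZl_EFin//; last first.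
  - exact: mprod.
  - by move=> y _; rewrite lee_fin prodr_ge0.
  apply: eq_integral => y _; rewrite -EFinM big_ord_recl ccons0/=.
  by congr (_ * _)%:E; apply: eq_bigr => i _; rewrite cconsS.
have I0 : 0 <= I by rewrite -lee_fin -hI integral_ge0// => x _; rewrite lee_fin.
rewrite ge0_integralZl_EFin ?exprn_ge0//; last 2 first.
- by move=> x _; rewrite lee_fin.
- exact/measurable_EFinP.
by rewrite hI -EFinM exprSr.
Qed.

Lemma measurable_affine_cV n (z : 'cV[R]_n) (s : R) :
  measurable_fun [set: 'cV[R]_n] (fun w : 'cV[R]_n => z + s *: w).
Proof.
apply: measurable_fun_coorP => i; under eq_fun do rewrite !mxE.
apply: measurable_funD => //; apply: measurable_funM => //.
exact: measurable_coor.
Qed.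

(** A translation with dilation acts on each coordinate separately. Tonelli splits off the first
    coordinate, which contributes one factor s, and the induction hypothesis treats the tail. *)
Lemma ge0_integral_affine_cV n (z : 'cV[R]_n) (s : R) (f : 'cV[R]_n -> \bar R) :
  0 < s -> measurable_fun [set: 'cV[R]_n] f -> (forall x, (0 <= f x)%E) ->
  ((s ^+ n)%:E * \int[lebesgue_cV R n]_w f (z + s *: w)%R =
   \int[lebesgue_cV R n]_w f w)%E.
Proof.
move=> s0; elim: n z f => [|n IH] z f mf f0.
  rewrite expr0 mul1e; apply: eq_integral => w _.
  by rewrite [w]flatmx0 [z]flatmx0 scaler0 addr0.
have mfc : measurable_fun setT (f \o @ccons R n).
  by apply: measurableT_comp => //; exact: measurable_ccons.
have mf1 x : measurable_fun setT (fun y => f (ccons (x, y))).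
  exact: (measurableT_comp mfc (measurable_pair1 x)).
rewrite !ge0_integral_cVS//; last first.
  by apply: measurableT_comp => //; exact: measurable_affine_cV.
pose F x := (\int[lebesgue_cV R n]_y f (ccons (x, y)))%E.
have mF : measurable_fun setT F.
  refine (@measurable_fun_fubini_tonelli_F _ _ _ _ _ (lebesgue_cV R n)
    (f \o @ccons R n) mfc _) => p; exact: f0.
have F0 x : (0 <= F x)%E by exact: integral_ge0.
rewrite -[RHS](ge0_integral_affine (z ord0 ord0) s0 mF F0).
rewrite exprS EFinM -muleA; congr (_ * _)%E.
rewrite -ge0_integralZl_EFin ?exprn_ge0 ?ltW//; last 2 first.
- by move=> x _; exact: integral_ge0.
- refine (@measurable_fun_fubini_tonelli_F _ _ _ _ _ (lebesgue_cV R n)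
    (fun p => f (z + s *: ccons p)) _ _) => //=.
  apply: (measurableT_comp mf).
  exact: (measurableT_comp (measurable_affine_cV z s) (@measurable_ccons R n)).
apply: eq_integral => x _.
rewrite /F -[RHS](IH (\col_i z (lift ord0 i) ord0) _ (mf1 _) (fun y => f0 _)).
congr (_ * _)%E.
apply: eq_integral => y _; congr f; apply/colP => i.
rewrite [LHS]mxE [X in _ + X]mxE.
have [j ->|->] := unliftP ord0 i; last by rewrite !ccons0.
by rewrite !cconsS !mxE.
Qed.

Lemma integral_affine_cV n (z : 'cV[R]_n) (s : R) (f : 'cV[R]_n -> R) :
  0 < s -> (lebesgue_cV R n).-integrable setT (EFin \o f) ->
  s ^+ n * \int[lebesgue_cV R n]_w f (z + s *: w)%R =
  \int[lebesgue_cV R n]_w f w.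
Proof.
move=> s0 fint; have mf := measurable_int _ fint.
have pos g : measurable_fun setT g -> (forall x, (0 <= g x)%E) ->
    (\int[lebesgue_cV R n]_w g (z + s *: w)%R =
     ((s ^+ n)^-1)%:E * \int[lebesgue_cV R n]_w g w)%E.
  move=> mg g0; rewrite -(ge0_integral_affine_cV z s0 mg g0) muleA -EFinM.
  by rewrite mulVf ?mul1e// expf_neq0// gt_eqF.
have E : (\int[lebesgue_cV R n]_w (f (z + s *: w))%:E =
    ((s ^+ n)^-1)%:E * \int[lebesgue_cV R n]_w (f w)%:E)%E.
  rewrite integralE [X in (_ * X)%E]integralE muleBr//; last first.
    apply: fin_num_adde_defl; rewrite fin_numN; exact: integrable_neg_fin_num.
  rewrite -[fun w => (f (z + _))%:E]/((EFin \o f) \o (fun w => z + s *: w)).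
  rewrite funepos_comp funeneg_comp; congr (_ - _)%E.
  - refine (pos ((EFin \o f)^\+)%E _ _); last exact: funepos_ge0.
    exact: measurable_funepos.
  - refine (pos ((EFin \o f)^\-)%E _ _); last exact: funeneg_ge0.
    exact: measurable_funeneg.
rewrite /Rintegral E fineM//; last exact: integrable_fin_num.
by rewrite mulrA divff ?mul1r// expf_neq0// gt_eqF.
Qed.

End lebesgue_cV_integral.

Section dominated_convergence_filter.
Context d (T : measurableType d) (R : realType) (mu : {measure set T -> \bar R}).
Context (X : Type) (F : set_system X) {FF : ProperFilter F}.

(** Reduction to sequences: [U] plays the role of a countable base of [F]. If the integrals did not
    converge, each [U n] would contain a point with error at least e; these points converge along
    [F], contradicting sequential dominated convergence. It serves both neighbourhoods of (z, t) and
    the one-sided limit t -> 0. *)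
Lemma dominated_cvg_filter (U : (set X)^nat) (f : X -> T -> R) (g G : T -> R) :
  (forall n, F (U n)) ->
  (forall A, F A -> exists N, forall n, (N <= n)%N -> U n `<=` A) ->
  (\forall x \near F, measurable_fun [set: T] (f x)) ->
  mu.-integrable setT (EFin \o G) ->
  (\forall x \near F, forall y, `|f x y| <= G y) ->
  (forall y, f x y @[x --> F] --> g y) ->
  \int[mu]_y f x y @[x --> F] --> \int[mu]_y g y.
Proof.
move=> FU Ubase mf intG fG fg; apply/cvgrPdist_lt => e e0.
apply: contrapT => nF.
have bad n : exists x, [/\ U n x, measurable_fun setT (f x),
    (forall y, `|f x y| <= G y) & e <= `|\int[mu]_y g y - \int[mu]_y f x y|].
  apply: contrapT => /forallNP nex; apply: nF.
  near=> x; rewrite ltNge; apply/negP => ex.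
  apply: (nex x); split=> //.
  - by near: x; exact: FU.
  - by near: x.
  - by near: x.
have [x /all_and4[xU mx xG xe]] := choice bad.
have xF : x n @[n --> \oo] --> F.
  by move=> A /Ubase[N NA]; exists N => // n /= /NA UA; exact/UA/xU.
have mg : measurable_fun setT g.
  apply: (@measurable_fun_cvg _ _ _ setT (fun n => f (x n))) => // y _.
  exact: (cvg_comp _ _ xF (fg y)).
have [ig _ cvgI] : [/\ mu.-integrable setT (EFin \o g), True &
    \int[mu]_y (f (x n) y)%:E @[n --> \oo] --> \int[mu]_y (g y)%:E]%E.
  have [] := @dominated_convergence _ _ _ mu setT measurableT
    (fun n y => (f (x n) y)%:E) (EFin \o g) (EFin \o G) => //.
  - by move=> n; exact/measurable_EFinP.
  - exact/measurable_EFinP.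
  - apply/aeW => y _; apply: cvg_EFin; first exact: nearW.
    exact: (cvg_comp _ _ xF (fg y)).
  - by apply/aeW => y n _; rewrite lee_fin.
have {}cvgI : \int[mu]_y f (x n) y @[n --> \oo] --> \int[mu]_y g y.
  by apply: fine_cvg; rewrite fineK//; exact: integrable_fin_num.
move/cvgrPdist_lt : cvgI => /(_ _ e0)[N _ /(_ _ (leqnn N))/=].
by rewrite ltNge xe.
Unshelve. all: by end_near. Qed.

End dominated_convergence_filter.

Section gauss_cV.
Context (R : realType).

Lemma measurable_dotp n (f g : 'cV[R]_n -> 'cV[R]_n) :
  (forall i, measurable_fun [set: 'cV[R]_n] (fun z => f z i ord0)) ->
  (forall i, measurable_fun [set: 'cV[R]_n] (fun z => g z i ord0)) ->
  measurable_fun [set: 'cV[R]_n] (fun z => dotp (f z) (g z)).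
Proof.
by move=> mf mg; apply: measurable_sum => i; exact: measurable_funM.
Qed.

Lemma dotp_ge0 n (z : 'cV[R]_n) : 0 <= dotp z z.
Proof. by apply: sumr_ge0 => i _; rewrite -expr2 sqr_ge0. Qed.

Lemma integral_gauss_cV n (c : R) : 0 < c ->
  (\int[lebesgue_cV R n]_w (expR (- (c * dotp w w)))%:E =
   ((Num.sqrt pi / Num.sqrt c) ^+ n)%:E)%E.
Proof.
move=> c0; have sc0 : 0 < Num.sqrt c by rewrite sqrtr_gt0.
have mgauss : measurable_fun [set: measurableTypeR R]
    (fun x : R => expR (- (c * x ^+ 2))).
  apply: measurableT_comp => //; apply: measurableT_comp => //.
  by apply: measurable_funM => //; exact: measurable_funX.
have I1 : (\int[@lebesgue_measure R]_x (expR (- (c * x ^+ 2)))%:E =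
    (Num.sqrt pi / Num.sqrt c)%:E)%E.
  (* Dilation by sqrt c reduces the line integral to the standard Gaussian integral. *)
  have := @ge0_integral_affine R 0 _ (fun x => (gauss_fun x)%:E) sc0.
  rewrite integralT_gauss => E.
  transitivity ((Num.sqrt c)^-1%:E * (Num.sqrt pi)%:E)%E; last first.
    by rewrite -EFinM mulrC.
  rewrite -{}E; first last.
  - by move=> x; rewrite lee_fin gauss_fun_ge0.
  - by apply/measurable_EFinP; exact: measurable_gauss_fun.
  rewrite muleA -EFinM mulVf ?gt_eqF// mul1e; apply: eq_integral => x _.
  by rewrite add0r /gauss_fun exprMn sqr_sqrtr// ltW.
rewrite -(ge0_integral_prod_cV n mgauss _ I1); last by move=> x; exact: expR_ge0.
apply: eq_integral => w _; congr EFin; rewrite -expR_sum; congr expR.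
by rewrite sumrN mulr_sumr; congr (- _); apply: eq_bigr => i _; rewrite expr2.
Qed.

Lemma integrable_gauss_cV n (c : R) : 0 < c ->
  (lebesgue_cV R n).-integrable setT (fun w => (expR (- (c * dotp w w)))%:E).
Proof.
move=> c0; apply/integrableP; split.
  apply/measurable_EFinP; do 2 apply: measurableT_comp => //.
  apply: measurable_funM => //; apply: measurable_dotp => i; exact: measurable_coor.
under eq_integral do rewrite /= ger0_norm ?expR_ge0//.
by rewrite integral_gauss_cV// ltry.
Qed.

End gauss_cV.

Section essential_bound.
Context (R : realType) (n : nat).

(** If |f| exceeded the essential bound at a point, it would do so on a whole sup-norm ball around
    it. Such a ball is a box of measure (2e)^n > 0, yet it would lie in a null set. *)
Lemma continuous_Loo_bounded (f : 'cV[R]_n -> R) : continuous f ->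
  f \in Lfun (lebesgue_cV R n) +oo%E -> exists K : R, forall z, `|f z| <= K.
Proof.
move=> cf /andP[_ /[!inE]]; rewrite /finite_norm unlock => foo.
have [K [N [mN N0 fN]]] : exists K : R, {ae lebesgue_cV R n, forall z, `|f z| <= K}.
  (* The norm at [+oo] is an essential supremum only when the whole space has positive measure. In
     the other case the whole space is the exceptional null set. *)
  have [mu0|mu0] := boolP (0 < lebesgue_cV R n setT)%E.
    by move: foo; rewrite mu0 => /ess_supr_bounded.
  exists 0, setT; split=> //.
  by apply/eqP; rewrite -measure_le0 leNgt.
exists K => z0; rewrite leNgt; apply/negP => Kf.
have : \forall z \near z0, K < `|f z|.
  have cnf : `|f z| @[z --> z0] --> `|f z0| by exact: (cvg_norm (cf z0)).
  exact: (cvgr_gt _ cnf).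
move=> /nbhs_ballP[e /= e0 ze].
pose A (i : 'I_n) : set (measurableTypeR R) := `]z0 i ord0 - e, z0 i ord0 + e[%classic.
have mA i : measurable (A i) by exact: measurable_itv.
have : (lebesgue_cV R n [set z | forall i, A i (z i ord0)] <= 0)%E.
  rewrite -N0 le_measure ?inE//; first exact: measurable_box.
  move=> z Az; apply: fN => /=; apply/negP; rewrite -ltNge; apply: ze.
  split=> // i j; rewrite ord1; have := Az i; rewrite /A/= in_itv/=.
  by rewrite -ltr_distlC /ball/= distrC.
rewrite lebesgue_cV_box//; apply/negP; rewrite -ltNge.
under eq_bigr do rewrite lebesgue_measure_itv/= lte_fin ltrD2l gtrN// -EFinD.
rewrite prodEFin lte_fin prodr_gt0// => i _; lra.
Qed.

End essential_bound.

(** * The hyperbolic coefficients *)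

Section hyperbolic.
Context (R : realType).
Implicit Types x d t : R.

Lemma is_derive_sinh x : is_derive x 1 (@sinh R) (cosh x).
Proof.
rewrite /sinh; apply: is_derive_eq.
by rewrite /cosh !scaler0 add0r /GRing.scale/=; field.
Qed.

Lemma is_derive_cosh x : is_derive x 1 (@cosh R) (sinh x).
Proof.
rewrite /cosh; apply: is_derive_eq.
by rewrite /sinh !scaler0 add0r /GRing.scale/=; field.
Qed.

Lemma cosh2Bsinh2 x : cosh x ^+ 2 - sinh x ^+ 2 = 1.
Proof.
have : expR x * expR (- x) = 1 by rewrite -expRD subrr expR0.
by rewrite /cosh /sinh => E; rewrite -[RHS]E; field.
Qed.

Lemma sinh_gt0 x : 0 < x -> 0 < sinh x.
Proof.
move=> x0; rewrite /sinh divr_gt0// subr_gt0 ltr_expR; lra.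
Qed.

Lemma cosh_gt0 x : 0 < cosh x.
Proof. by rewrite /cosh divr_gt0// addr_gt0 ?expR_gt0. Qed.

(* For t > 0, ccof d t = j(2td)/(4t) and bcof d t = j(2td)cosh(2td)/(4t). The
   case split on d keeps each branch differentiable as it stands, whereas jfun
   branches on its argument. *)
Definition ccof d t : R := if d == 0 then (4 * t)^-1 else d / (2 * sinh (2 * t * d)).
Definition bcof d t : R :=
  if d == 0 then (4 * t)^-1 else d * cosh (2 * t * d) / (2 * sinh (2 * t * d)).

Lemma ccofE d t : 0 < t -> ccof d t = jfun (2 * t * d) / (4 * t).
Proof.
move=> t0; rewrite /ccof /jfun mulf_eq0 (gt_eqF (_ : 0 < 2 * t)) ?mulr_gt0//=.
case: ifPn => d0; first by rewrite div1r.
have [->|s0] := eqVneq (sinh (2 * t * d)) 0; first by rewrite !(mulr0, invr0, mul0r).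
by field; rewrite s0 gt_eqF.
Qed.

Lemma bcofE d t : 0 < t -> bcof d t = ccof d t * cosh (2 * t * d).
Proof.
move=> t0; rewrite /bcof /ccof; case: ifPn => [/eqP->|d0].
  by rewrite mulr0 /cosh oppr0 expR0 -[1 + 1]/2 divff ?mulr1.
by rewrite mulrAC.
Qed.

Lemma ccof_gt0 d t : 0 <= d -> 0 < t -> 0 < ccof d t.
Proof.
rewrite le_eqVlt => /predU1P[<-|d0] t0; rewrite /ccof.
  by rewrite eqxx invr_gt0 mulr_gt0.
by rewrite gt_eqF// divr_gt0// mulr_gt0// sinh_gt0// !mulr_gt0.
Qed.

Lemma bcof_gt0 d t : 0 <= d -> 0 < t -> 0 < bcof d t.
Proof. by move=> d0 t0; rewrite bcofE// mulr_gt0 ?ccof_gt0 ?cosh_gt0. Qed.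

(** A rescaled form of cosh^2 - sinh^2 = 1. It yields both inequalities below, the limit b - c -> 0,
    and the final cancellation in [kernel_pde]. *)
Lemma bcof_sqr d t : 0 <= d -> 0 < t ->
  bcof d t ^+ 2 = ccof d t ^+ 2 + d ^+ 2 / 4.
Proof.
rewrite le_eqVlt => /predU1P[<-|d0] t0; rewrite /ccof /bcof.
  by rewrite eqxx expr0n mul0r addr0.
rewrite gt_eqF//.
have s0 : sinh (2 * t * d) != 0 by rewrite gt_eqF// sinh_gt0// !mulr_gt0.
have := cosh2Bsinh2 (2 * t * d) => /eqP; rewrite subr_eq => /eqP E.
by rewrite expr_div_n exprMn E; field.
Qed.

Lemma ccof_le_bcof d t : 0 <= d -> 0 < t -> ccof d t <= bcof d t.
Proof.
move=> d0 t0; have := bcof_sqr d0 t0; have := ccof_gt0 d0 t0; have := bcof_gt0 d0 t0.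
nra.
Qed.

(** The kernel decays in each eigencoordinate with rate b while the data may grow with rate d/2; the
    strict gap makes their product integrable at every positive time. *)
Lemma bcof_gt d t : 0 <= d -> 0 < t -> d / 2 < bcof d t.
Proof.
move=> d0 t0; have := bcof_sqr d0 t0; have := ccof_gt0 d0 t0; have := bcof_gt0 d0 t0.
nra.
Qed.

(** The sum and product rules are restated for explicit abstractions, the second with real
    multiplication instead of scaling, so that derivatives of concrete formulas can be assembled as
    terms. *)
Lemma is_derive_fD (f g : R -> R) x df dg :
  is_derive x 1 f df -> is_derive x 1 g dg ->
  is_derive x 1 (fun y => f y + g y) (df + dg).
Proof. by move=> dfx dgx; exact: is_deriveD. Qed.

Lemma is_derive_fM (f g : R -> R) x df dg :
  is_derive x 1 f df -> is_derive x 1 g dg ->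
  is_derive x 1 (fun y => f y * g y) (df * g x + f x * dg).
Proof.
move=> dfx dgx; have H := is_deriveM dfx dgx.
by apply: (is_derive_eq H); rewrite /GRing.scale/=; ring.
Qed.

Let is_derive_lin d t : is_derive t 1 (fun u => 2 * u * d) (2 * d).
Proof. by apply: is_derive_eq; rewrite /GRing.scale/=; ring. Qed.

Let is_derive_sinh_lin d t :
  is_derive t 1 (fun u => 2 * sinh (2 * u * d)) (4 * d * cosh (2 * t * d)).
Proof.
have ds := is_derive1_comp (is_derive_sinh _) (is_derive_lin d t).
refine (is_derive_eq (is_derive_fM (is_derive_cst (2 : R) t 1) ds) _).
by rewrite /GRing.scale/=; ring.
Qed.

Let is_derive_cosh_lin d t :
  is_derive t 1 (fun u => d * cosh (2 * u * d)) (2 * d ^+ 2 * sinh (2 * t * d)).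
Proof.
have ds := is_derive1_comp (is_derive_cosh _) (is_derive_lin d t).
refine (is_derive_eq (is_derive_fM (is_derive_cst d t 1) ds) _).
by rewrite /GRing.scale/=; ring.
Qed.

Let is_derive_inv4 t : 0 < t ->
  is_derive t 1 (fun u => (4 * u)^-1) (- (4 * (4 * t)^-1 ^+ 2)).
Proof.
move=> t0; have t4 : 4 * t != 0 by rewrite gt_eqF// mulr_gt0.
apply: (is_derive_eq (is_deriveV (f := fun t => 4 * t) t4 _)).
by rewrite /GRing.scale/= mulr1; field; rewrite gt_eqF.
Qed.

Lemma is_derive_ccof d t : 0 <= d -> 0 < t ->
  is_derive t 1 (ccof d) (- (4 * bcof d t * ccof d t)).
Proof.
rewrite le_eqVlt => /predU1P[<-|d0] t0; rewrite /ccof /bcof.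
  by rewrite eqxx; apply: (is_derive_eq (is_derive_inv4 t0)); rewrite expr2 mulrA.
rewrite (gt_eqF d0).
have s0 : sinh (2 * t * d) != 0 by rewrite gt_eqF// sinh_gt0// !mulr_gt0.
have sh0 : 2 * sinh (2 * t * d) != 0 by rewrite mulf_neq0.
refine (is_derive_eq (is_derive_fM (is_derive_cst d t 1)
  (is_deriveV (f := fun u => 2 * sinh (2 * u * d)) sh0 (is_derive_sinh_lin d t))) _).
by rewrite /GRing.scale/=; field.
Qed.

Lemma is_derive_bcof d t : 0 <= d -> 0 < t ->
  is_derive t 1 (bcof d) (- (4 * ccof d t ^+ 2)).
Proof.
rewrite le_eqVlt => /predU1P[<-|d0] t0; rewrite /ccof /bcof.
  by rewrite eqxx; exact: is_derive_inv4.
rewrite (gt_eqF d0).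
have s0 : sinh (2 * t * d) != 0 by rewrite gt_eqF// sinh_gt0// !mulr_gt0.
have sh0 : 2 * sinh (2 * t * d) != 0 by rewrite mulf_neq0.
have := cosh2Bsinh2 (2 * t * d) => /eqP; rewrite subr_eq => /eqP E.
refine (is_derive_eq (is_derive_fM (is_derive_cosh_lin d t)
  (is_deriveV (f := fun u => 2 * sinh (2 * u * d)) sh0 (is_derive_sinh_lin d t))) _).
rewrite /GRing.scale/=.
have -> : d * cosh (2 * t * d) *
    (- (2 * sinh (2 * t * d)) ^- 2 * (4 * d * cosh (2 * t * d))) =
    - (d ^+ 2 * (1 + sinh (2 * t * d) ^+ 2) / sinh (2 * t * d) ^+ 2).
  by rewrite -E; field.
by field.
Qed.

(** Off 0, j(h) is the inverse of the difference quotient sinh h / h, which tends to sinh'(0) = cosh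
    0 = 1. *)
Lemma cvg_jfun : {for 0, continuous (@jfun R)}.
Proof.
have ds := is_derive_sinh 0.
have s0 : @sinh R 0 = 0 by rewrite /sinh oppr0 subrr mul0r.
have c0 : @cosh R 0 = 1 by rewrite /cosh oppr0 expR0 -[1 + 1]/2 divff.
have [dv] := ds; rewrite c0 => E.
have H : (fun h => h^-1 *:
    (((@sinh R) \o shift 0) (h *: (1 : R)) - @sinh R 0)) @ 0^' --> (1 : R).
  by rewrite -[X in _ --> X]E; exact: dv.
have sh : @sinh R h / h @[h --> 0^'] --> (1 : R).
  apply: cvg_trans H; apply: near_eq_cvg; near=> h.
  by rewrite /= s0 subr0 addr0 /GRing.scale/= mulr1 mulrC.
have jh : @jfun R h @[h --> 0^'] --> (1 : R).
  have sV : (@sinh R h / h)^-1 @[h --> 0^'] --> (1 : R).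
    by rewrite -[X in _ --> X]invr1; apply: cvgV => //; exact: oner_neq0.
  apply: cvg_trans sV.
  apply: near_eq_cvg; near=> h; rewrite /jfun invf_div ifF//.
  apply/negbTE; near: h; exact: nbhs_dnbhs_neq.
have j0 : @jfun R 0 = 1 by rewrite /jfun eqxx.
by apply/continuous_withinNx; rewrite j0.
Unshelve. all: by end_near. Qed.

End hyperbolic.

(** * The kernel in eigencoordinates *)

Section eigencoordinates.
Context (R : realType) (n : nat) (P : 'M[R]_n) (d : 'rV[R]_n).
Implicit Types (z w zeta : 'cV[R]_n) (t : R).

Definition amplitude t : R := \prod_k Num.sqrt (ccof (d ord0 k) t / pi).

Definition phase z zeta t : R :=
  \sum_k (bcof (d ord0 k) t * ((P *m z) k ord0 ^+ 2 + (P *m zeta) k ord0 ^+ 2)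
          - 2 * ccof (d ord0 k) t * (P *m z) k ord0 * (P *m zeta) k ord0).

Lemma dotp_orthodiag (e : 'rV[R]_n) z w :
  dotp (P^T *m diag_mx e *m P *m z) w =
  \sum_k e ord0 k * (P *m z) k ord0 * (P *m w) k ord0.
Proof.
have dotpE x y : dotp x y = ((x^T *m y) ord0 ord0 : R).
  by rewrite mxE; apply: eq_bigr => i _; rewrite mxE.
rewrite dotpE !trmx_mul trmxK tr_diag_mx -!mulmxA mulmxA -trmx_mul mxE.
by apply: eq_bigr => k _; rewrite mul_diag_mx !mxE; ring.
Qed.

Hypothesis PP : P *m P^T = 1%:M.

Lemma dotp_rot z w : dotp z w = \sum_k (P *m z) k ord0 * (P *m w) k ord0.
Proof.
have := dotp_orthodiag (const_mx 1) z w.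
rewrite diag_const_mx mulmx1 (mulmx1C PP) mul1mx => ->.
by apply: eq_bigr => k _; rewrite mxE mul1r.
Qed.

Lemma orthodiag_ge0 : nonneg_definite (P^T *m diag_mx d *m P) ->
  forall k, 0 <= d ord0 k.
Proof.
move=> D0 k; have := D0 (P^T *m delta_mx k ord0).
rewrite dotp_orthodiag mulmxA PP mul1mx (bigD1 k)//= big1 ?addr0; last first.
  by move=> i ik; rewrite !mxE (negPf ik) mulr0.
by rewrite !mxE !eqxx !mulr1.
Qed.

Hypothesis d_ge0 : forall k, 0 <= d ord0 k.

(** [J] and [C] are diagonal in the same basis, so their product multiplies eigenvalues and det J is
    a product. The factor (4 pi t)^(-n/2) is distributed over the n eigenvalues, and j(2td) = 4tc
    turns each share into sqrt(c/pi). *)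
Lemma mehlerE z zeta t : 0 < t ->
  mehler (P^T *m diag_mx d *m P) z zeta t =
  amplitude t * expR (- phase z zeta t).
Proof.
move=> t0; set D := _ *m P.
have Dt : orthodiag ((2 * t) *: D) P ((2 * t) *: d).
  by split=> //; rewrite /D linearZ/= -scalemxAr scalemxAl.
rewrite /mehler !(mxfunE _ Dt).
set J := diag_mx (map_mx (@jfun R) _); set C := diag_mx _.
have JC : P^T *m J *m P *m (P^T *m C *m P) =
    P^T *m diag_mx (\row_k (jfun (2 * t * d ord0 k) * cosh (2 * t * d ord0 k))) *m P.
  rewrite -!mulmxA; congr (_ *m _); rewrite (mulmxA P) PP mul1mx mulmxA.
  congr (_ *m _); rewrite /C mulmx_diag; congr diag_mx.
  by apply/rowP => k; rewrite !mxE.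
rewrite JC !dotp_orthodiag; congr (_ * _).
  have -> : \det (P^T *m J *m P) = \prod_k jfun (2 * t * d ord0 k).
    rewrite !det_mulmx mulrAC -det_mulmx (mulmx1C PP) det1 mul1r det_diag.
    by apply: eq_bigr => k _; rewrite !mxE.
  have t4 : 0 < 4 * pi * t by rewrite !mulr_gt0// pi_gt0.
  have sqrt_prod (f : 'I_n -> R) : (forall k, 0 <= f k) ->
      Num.sqrt (\prod_k f k) = \prod_k Num.sqrt (f k).
    move=> f0; elim/big_rec2 : _ => [|k x y _ <-]; first exact: sqrtr1.
    by rewrite sqrtrM.
  rewrite powRN mulrC (_ : n%:R / 2 = 2^-1 * n%:R); last by rewrite mulrC.
  rewrite powRrM powR12_sqrt ?ltW// powR_mulrn ?sqrtr_ge0// -exprVn.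
  have jE k : jfun (2 * t * d ord0 k) = 4 * t * ccof (d ord0 k) t.
    by rewrite ccofE// [RHS]mulrC divfK// gt_eqF// mulr_gt0.
  rewrite sqrt_prod => [|k]; last first.
    by rewrite jE mulr_ge0// ?mulr_ge0 ?ltW// ccof_gt0.
  rewrite /amplitude -[n in _ ^+ n]card_ord -prodr_const -big_split/=.
  apply: eq_bigr => k _; rewrite -sqrtrV ?ltW// -sqrtrM; last first.
    by rewrite jE mulr_ge0// ?mulr_ge0 ?ltW// ccof_gt0.
  rewrite jE; congr Num.sqrt; have : (pi : R) != 0 by rewrite gt_eqF// pi_gt0.
  by move: (pi : R) => p p0; field; rewrite p0 gt_eqF.
congr expR; rewrite /phase -sumrN.
rewrite -big_split/= mulr_sumr -sumrB mulr_sumr; apply: eq_bigr => k _.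
rewrite bcofE// ccofE// !mxE.
by field; rewrite gt_eqF.
Qed.

End eigencoordinates.

(** * Integrals against the kernel *)

Section subgaussian_growth.
Context (R : realType) (n : nat).
Implicit Types (q : 'cV[R]_n * R -> 'cV[R]_n -> R) (p : 'cV[R]_n * R).
Implicit Types (zeta : 'cV[R]_n).

(* The functions q(z, t, zeta) that may multiply the kernel: the loss exp(e
   |zeta|^2), for every e > 0 and locally uniformly in (z, t), is absorbed by
   the Gaussian decay of kernel_bound. *)
Definition subgaussian q :=
  [/\ forall p, measurable_fun [set: 'cV[R]_n] (q p),
      forall p zeta, 0 < p.2 -> {for p, continuous (q^~ zeta)} &
      forall p e, 0 < p.2 -> 0 < e -> exists C, \forall p' \near p, forall zeta,
        `|q p' zeta| <= C * expR (e * dotp zeta zeta)].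

Lemma subgaussian_param (a : 'cV[R]_n * R -> R) :
  (forall p, 0 < p.2 -> {for p, continuous a}) -> subgaussian (fun p _ => a p).
Proof.
move=> ca; split=> [p|p zeta p0|p e p0 e0]; [exact: measurable_cst|exact: ca|].
exists (`|a p| + 1); near=> p' => zeta.
have ap : `|a p'| <= `|a p| + 1.
  near: p'; apply: (cvgr_le (`|a p|)); last by rewrite ltrDl.
  exact: (cvg_norm (ca p p0)).
rewrite -[leLHS]mulr1 ler_pM//.
by rewrite -expR0 ler_expR mulr_ge0 ?dotp_ge0// ltW.
Unshelve. all: by end_near. Qed.

Lemma subgaussian_cst (a : R) : subgaussian (fun _ _ => a).
Proof.
apply: (subgaussian_param (a := fun=> a)) => p _.
exact: (@cst_continuous ('cV[R]_n * R)%type R a).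
Qed.

Lemma subgaussianD q1 q2 : subgaussian q1 -> subgaussian q2 ->
  subgaussian (fun p zeta => q1 p zeta + q2 p zeta).
Proof.
move=> [m1 c1 b1] [m2 c2 b2]; split=> [p|p zeta p0|p e p0 e0].
- exact: measurable_funD.
- by apply: cvgD; [exact: c1|exact: c2].
- have [C1 B1] := b1 p e p0 e0; have [C2 B2] := b2 p e p0 e0.
  exists (C1 + C2); near=> p' => zeta; rewrite (le_trans (ler_normD _ _))//.
  by rewrite mulrDl lerD//; move: zeta; near: p'.
Unshelve. all: by end_near. Qed.

(** Closure under products is the reason for demanding the bound for every e > 0: each factor is
    used with e/2. *)
Lemma subgaussianM q1 q2 : subgaussian q1 -> subgaussian q2 ->
  subgaussian (fun p zeta => q1 p zeta * q2 p zeta).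
Proof.
move=> [m1 c1 b1] [m2 c2 b2]; split=> [p|p zeta p0|p e p0 e0].
- exact: measurable_funM.
- by apply: cvgM; [exact: c1|exact: c2].
- have e2 : 0 < e / 2 by rewrite divr_gt0.
  have [C1 B1] := b1 p _ p0 e2; have [C2 B2] := b2 p _ p0 e2.
  exists (C1 * C2); near=> p' => zeta; rewrite normrM.
  have -> : e * dotp zeta zeta = e / 2 * dotp zeta zeta + e / 2 * dotp zeta zeta.
    by rewrite -mulrDl -splitr.
  rewrite expRD mulrACA ler_pM//.
  + by move: zeta; near: p'.
  + by move: zeta; near: p'.
Unshelve. all: by end_near. Qed.

Lemma subgaussian_sum (I : Type) (r : seq I) (q : I -> 'cV[R]_n * R -> 'cV[R]_n -> R) :
  (forall i, subgaussian (q i)) ->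
  subgaussian (fun p zeta => \sum_(i <- r) q i p zeta).
Proof.
move=> sq; elim: r => [|i r IH].
  rewrite (_ : (fun _ _ => _) = (fun p zeta => 0)).
    exact: subgaussian_cst.
  by apply/funext => p; apply/funext => zeta; rewrite big_nil.
rewrite (_ : (fun _ _ => _) =
    (fun p zeta => q i p zeta + \sum_(i <- r) q i p zeta)).
  exact: subgaussianD.
by apply/funext => p; apply/funext => zeta; rewrite big_cons.
Qed.

Lemma subgaussian_coord i : subgaussian (fun _ zeta => zeta i ord0).
Proof.
split=> [p|p zeta p0|p e p0 e0]; [exact: measurable_coor| |].
  exact: (@cst_continuous ('cV[R]_n * R)%type R).
(* With x = |zeta_i|: x <= 1 + x^2 <= (1 + 1/e)(1 + e x^2), and 1 + e x^2 <= exp(e |zeta|^2). *)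
exists (1 + e^-1); near=> p' => zeta.
have zi : zeta i ord0 ^+ 2 <= dotp zeta zeta.
  rewrite /dotp (bigD1 i)//= -expr2 lerDl sumr_ge0// => j _.
  by rewrite -expr2 sqr_ge0.
apply: (@le_trans _ _ ((1 + e^-1) * (1 + e * zeta i ord0 ^+ 2))); last first.
  rewrite ler_pM2l ?addr_gt0 ?invr_gt0// (le_trans _ (expR_ge1Dx _))//.
  by rewrite lerD2l ler_pM2l.
have e'0 : 0 < e^-1 by rewrite invr_gt0.
have -> : (1 + e^-1) * (1 + e * zeta i ord0 ^+ 2) =
    1 + e^-1 + e * `|zeta i ord0| ^+ 2 + `|zeta i ord0| ^+ 2.
  by rewrite real_normK ?num_real//; field; rewrite gt_eqF.
set x := `|_|; have x1 : x <= 1 + x ^+ 2 by nra.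
have ex2 : 0 <= e * x ^+ 2 by rewrite mulr_ge0 ?sqr_ge0// ltW.
lra.
Unshelve. all: by end_near. Qed.

Lemma subgaussian_mulmx (P : 'M[R]_n) k : subgaussian (fun _ zeta => (P *m zeta) k ord0).
Proof.
rewrite (_ : (fun _ _ => _) = fun p zeta => \sum_i P k i * zeta i ord0); last first.
  by apply/funext => p; apply/funext => zeta; rewrite mxE.
apply: subgaussian_sum => i; apply: subgaussianM; last exact: subgaussian_coord.
exact: subgaussian_cst.
Qed.

End subgaussian_growth.

Section cvg_bigop.
Context (R : realType) (I T : Type) (F : set_system T) {FF : Filter F}.
Context (r : seq I) (f : I -> T -> R) (l : I -> R).

Lemma cvg_sum : (forall i, f i x @[x --> F] --> l i) ->
  \sum_(i <- r) f i x @[x --> F] --> \sum_(i <- r) l i.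
Proof.
by move=> fl; apply: cvg_big => [|i _]; [exact: add_continuous|exact: fl].
Qed.

Lemma cvg_prod : (forall i, f i x @[x --> F] --> l i) ->
  \prod_(i <- r) f i x @[x --> F] --> \prod_(i <- r) l i.
Proof.
by move=> fl; apply: cvg_big => [|i _]; [exact: mul_continuous|exact: fl].
Qed.

End cvg_bigop.

Section parameter_continuity.
Context (R : realType) (n : nat).
Implicit Types (p : 'cV[R]_n * R).

Lemma continuous_mulmx (P : 'M[R]_n) k :
  continuous (fun z : 'cV[R]_n => (P *m z) k ord0).
Proof.
rewrite (_ : (fun z => _) = fun z : 'cV[R]_n => \sum_i P k i * z i ord0).
  move=> z; apply: (@cvg_sum _ _ _ (nbhs z)) => i; apply: cvgMr.
  exact: coord_continuous.
by apply/funext => z; rewrite mxE.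
Qed.

Lemma continuous_mulmx_coord (P : 'M[R]_n) k p :
  {for p, continuous (fun p : 'cV[R]_n * R => (P *m p.1) k ord0)}.
Proof.
apply: (@continuous_comp _ _ _ fst (fun z : 'cV[R]_n => (P *m z) k ord0)).
  exact: cvg_fst.
exact: continuous_mulmx.
Qed.

Lemma continuous_bcof p d : 0 <= d -> 0 < p.2 ->
  {for p, continuous (fun p : 'cV[R]_n * R => bcof d p.2)}.
Proof.
move=> d0 p0; apply: (@continuous_comp _ _ _ snd (bcof d)); first exact: cvg_snd.
apply/differentiable_continuous/derivable1_diffP.
by have [] := is_derive_bcof d0 p0.
Qed.

Lemma continuous_ccof p d : 0 <= d -> 0 < p.2 ->
  {for p, continuous (fun p : 'cV[R]_n * R => ccof d p.2)}.
Proof.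
move=> d0 p0; apply: (@continuous_comp _ _ _ snd (ccof d)); first exact: cvg_snd.
apply/differentiable_continuous/derivable1_diffP.
by have [] := is_derive_ccof d0 p0.
Qed.

End parameter_continuity.

(** The witness 1 / (1 + sum of 1/f_i) replaces a minimum and also covers the empty family, which
    occurs when n = 0. *)
Lemma finite_pos_lb (R : realType) (m : nat) (f : 'I_m -> R) : (forall i, 0 < f i) ->
  exists c, 0 < c /\ forall i, c <= f i.
Proof.
move=> f0; have s0 (Q : pred 'I_m) : 0 <= \sum_(i | Q i) (f i)^-1.
  by apply: sumr_ge0 => i _; rewrite invr_ge0 ltW.
exists (1 + \sum_i (f i)^-1)^-1; split.
  by rewrite invr_gt0 (lt_le_trans ltr01)// lerDl s0.
move=> i; rewrite -[leRHS]invrK lef_pV2 ?posrE ?invr_gt0//; last first.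
  by rewrite (lt_le_trans ltr01)// lerDl s0.
by rewrite (bigD1 i)//= addrCA lerDl addr_ge0.
Qed.

Section kernel.
Context (R : realType) (n : nat) (P : 'M[R]_n) (d : 'rV[R]_n).
Hypothesis PP : P *m P^T = 1%:M.
Hypothesis d_ge0 : forall k, 0 <= d ord0 k.
Implicit Types (p : 'cV[R]_n * R) (zeta : 'cV[R]_n).

Definition kernel p zeta := amplitude d p.2 * expR (- phase P d p.1 zeta p.2).

Lemma continuous_amplitude p : 0 < p.2 ->
  {for p, continuous (fun p : 'cV[R]_n * R => amplitude d p.2)}.
Proof.
move=> p0; apply: cvg_prod => k.
apply: (@continuous_comp _ _ _ (fun p : 'cV[R]_n * R => ccof (d ord0 k) p.2 / pi)).
  by apply: cvgMl; exact: continuous_ccof.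
exact: sqrt_continuous.
Qed.

Lemma continuous_phase p zeta : 0 < p.2 ->
  {for p, continuous (fun p : 'cV[R]_n * R => phase P d p.1 zeta p.2)}.
Proof.
move=> p0; apply: cvg_sum => k.
have cY := @continuous_mulmx_coord R n P k p.
apply: cvgB.
  apply: cvgM; first exact: continuous_bcof.
  by apply: cvgD; [apply: (@cvgM _ _ _ _ _ _ _ _ cY cY)|exact: cvg_cst].
apply: cvgMl; apply: cvgM; last exact: cY.
by apply: cvgMr; exact: continuous_ccof.
Qed.

Lemma continuous_kernel p zeta : 0 < p.2 -> {for p, continuous (kernel^~ zeta)}.
Proof.
move=> p0; apply: cvgM; first exact: continuous_amplitude.
apply: (@continuous_comp _ _ _ (fun p : 'cV[R]_n * R => - phase P d p.1 zeta p.2)).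
  by apply: cvgN; exact: continuous_phase.
exact: continuous_expR.
Qed.

Lemma measurable_mulmx_coord k :
  measurable_fun [set: 'cV[R]_n] (fun zeta : 'cV[R]_n => (P *m zeta) k ord0).
Proof.
under eq_fun do rewrite mxE.
apply: measurable_sum => i; apply: measurable_funM => //; exact: measurable_coor.
Qed.

Lemma measurable_kernel p : measurable_fun [set: 'cV[R]_n] (kernel p).
Proof.
apply: measurable_funM => //; apply: measurableT_comp => //.
apply: measurableT_comp => //; apply: measurable_sum => k.
have mY := measurable_mulmx_coord k.
apply: measurable_funB; apply: measurable_funM => //.
by apply: measurable_funD => //; exact: measurable_funX.
Qed.

Lemma amplitude_ge0 t : 0 <= amplitude d t.
Proof. by apply: prodr_ge0 => k _; exact: sqrtr_ge0. Qed.

Context (v0 : 'cV[R]_n -> R) (K : R).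
Hypothesis mv0 : measurable_fun [set: 'cV[R]_n] v0.
Hypothesis v0_bound : forall zeta,
  `|v0 zeta| <= K * expR (1 / 2 * \sum_k d ord0 k * (P *m zeta) k ord0 ^+ 2).

Lemma growth_constant_ge0 : 0 <= K.
Proof.
have := le_trans (normr_ge0 _) (v0_bound 0).
by rewrite pmulr_lge0// expR_gt0.
Qed.

(** For each k, the growth of [v0] lowers the coefficient b of eta^2 to b - d_k/2, which is at least
    beta near [p]. Young's inequality spends beta/2 of it on the cross term 2 c y eta, and the other
    beta/2 is the Gaussian decay. *)
Lemma kernel_bound p : 0 < p.2 -> exists C c, 0 < c /\ \forall p' \near p,
  forall zeta, `|kernel p' zeta * v0 zeta| <= C * expR (- (c * dotp zeta zeta)).
Proof.
move=> p0; pose beta k := (bcof (d ord0 k) p.2 - d ord0 k / 2) / 2.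
have beta0 k : 0 < beta k by rewrite divr_gt0// subr_gt0 bcof_gt.
have [c [c0 cbeta]] : exists c, 0 < c /\ forall k, c <= beta k / 2.
  by apply: finite_pos_lb => k; rewrite divr_gt0.
(* The sum of the remainders 2 c^2 y^2 / beta in Young's inequality. Being continuous, it stays
   below B p + 1 near [p]. *)
pose B p := \sum_k 2 * ccof (d ord0 k) p.2 ^+ 2 * (P *m p.1) k ord0 ^+ 2 / beta k.
have cB : {for p, continuous B}.
  apply: cvg_sum => k; apply: cvgMl.
  have cY := @continuous_mulmx_coord R n P k p.
  have cC := continuous_ccof (d_ge0 k) p0.
  apply: cvgM; last exact: (cvgM cY cY).
  by apply: cvgMr; exact: (cvgM cC cC).
exists ((amplitude d p.2 + 1) * expR (B p + 1) * K), c; split=> //.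
near=> p' => zeta.
have A1 : amplitude d p'.2 <= amplitude d p.2 + 1.
  near: p'; apply: (cvgr_le (amplitude d p.2)); last by rewrite ltrDl.
  exact: continuous_amplitude.
have B1 : B p' <= B p + 1.
  near: p'; apply: (cvgr_le (B p)); last by rewrite ltrDl.
  exact: cB.
have beta1 k : beta k <= bcof (d ord0 k) p'.2 - d ord0 k / 2.
  move: k; near: p'; apply: filter_forall => k.
  have /cvgr_ge : bcof (d ord0 k) p'.2 @[p' --> p] --> bcof (d ord0 k) p.2.
    exact: continuous_bcof.
  move=> /(_ (beta k + d ord0 k / 2)) H.
  have : \forall p' \near p, beta k + d ord0 k / 2 <= bcof (d ord0 k) p'.2.
    apply: H; have := beta0 k; rewrite /beta; lra.
  by apply: filterS => x; rewrite -lerBrDr.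
have b0 k : 0 < bcof (d ord0 k) p'.2.
  by have := beta1 k; have := beta0 k; have := d_ge0 k; lra.
have ex : - phase P d p'.1 zeta p'.2 +
    1 / 2 * (\sum_k d ord0 k * (P *m zeta) k ord0 ^+ 2) <=
    B p' - c * dotp zeta zeta.
  rewrite (dotp_rot PP) !mulr_sumr -sumrN -big_split/= -sumrB.
  apply: ler_sum => k _.
  have := beta0 k; have := beta1 k; have := b0 k; have := cbeta k.
  set b := bcof _ _; set cc := ccof _ _; set y := (P *m p'.1) _ _.
  set eta := (P *m zeta) _ _ => cb bp bb be.
  (* Young: [2 cc y eta <= (beta/2) eta^2 + 2 cc^2 y^2 / beta] *)
  have young : 2 * cc * y * eta <=
      beta k / 2 * eta ^+ 2 + 2 * cc ^+ 2 * y ^+ 2 / beta k.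
    rewrite -subr_ge0 [leRHS](_ : _ = (beta k * eta - 2 * cc * y) ^+ 2 / (2 * beta k)).
      by rewrite mulr_ge0 ?sqr_ge0// invr_ge0 mulr_ge0// ltW.
    by field; rewrite gt_eqF.
  have y2 : 0 <= b * y ^+ 2 by rewrite mulr_ge0 ?sqr_ge0// ltW.
  have e2 := sqr_ge0 eta.
  have ce : c * eta ^+ 2 <= beta k / 2 * eta ^+ 2 by rewrite ler_wpM2r.
  have be2 : beta k * eta ^+ 2 <= (b - d ord0 k / 2) * eta ^+ 2 by rewrite ler_wpM2r.
  lra.
rewrite normrM /kernel normrM (ger0_norm (amplitude_ge0 _)) (ger0_norm (expR_ge0 _)).
apply: (@le_trans _ _ (amplitude d p'.2 * expR (- phase P d p'.1 zeta p'.2) *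
  (K * expR (1 / 2 * \sum_k d ord0 k * (P *m zeta) k ord0 ^+ 2)))).
  by rewrite ler_wpM2l// mulr_ge0 ?amplitude_ge0 ?expR_ge0.
rewrite mulrACA -expRD.
rewrite [leRHS](_ : _ = (amplitude d p.2 + 1) * K *
  (expR (B p + 1) * expR (- (c * dotp zeta zeta)))); last by ring.
rewrite -expRD ler_pM ?expR_ge0//.
- by rewrite mulr_ge0 ?amplitude_ge0 ?growth_constant_ge0.
- by rewrite ler_wpM2r ?growth_constant_ge0.
- by rewrite ler_expR (le_trans ex)// lerD2r.
Unshelve. all: by end_near. Qed.

Definition kint q p := \int[lebesgue_cV R n]_zeta (q p zeta * (kernel p zeta * v0 zeta)).

(** Half of the rate c from [kernel_bound] pays for the growth of q. The same G serves a whole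
    neighbourhood of [p], as required for integrability, continuity and differentiation. *)
Lemma kint_dominated q p : subgaussian q -> 0 < p.2 ->
  exists G : 'cV[R]_n -> R, [/\ forall zeta, 0 <= G zeta,
    (lebesgue_cV R n).-integrable setT (EFin \o G) &
    \forall p' \near p, forall zeta, `|q p' zeta * (kernel p' zeta * v0 zeta)| <= G zeta].
Proof.
move=> [_ _ qb] p0; have [C [c [c0 kb]]] := kernel_bound p0.
have c2 : 0 < c / 2 by rewrite divr_gt0.
have {qb}[C' qb] := qb p _ p0 c2.
exists (fun zeta => `|C * C'| * expR (- (c / 2 * dotp zeta zeta))); split.
- by move=> zeta; rewrite mulr_ge0// expR_ge0.
- rewrite (_ : _ \o _ = fun zeta =>
      (`|C * C'|%:E * (expR (- (c / 2 * dotp zeta zeta)))%:E)%E)//.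
  by apply: integrableZl => //; exact: integrable_gauss_cV.
- near=> p' => zeta.
  have kp : `|kernel p' zeta * v0 zeta| <= C * expR (- (c * dotp zeta zeta)).
    by move: zeta; near: p'.
  have qp : `|q p' zeta| <= C' * expR (c / 2 * dotp zeta zeta).
    by move: {kp} zeta; near: p'.
  rewrite normrM mulrC (le_trans (ler_pM _ _ kp qp))//.
  rewrite mulrACA -expRD.
  have -> : - (c * dotp zeta zeta) + c / 2 * dotp zeta zeta =
      - (c / 2 * dotp zeta zeta) by field.
  by rewrite ler_wpM2r ?expR_ge0// ler_norm.
Unshelve. all: by end_near. Qed.

Lemma measurable_kint q p : subgaussian q ->
  measurable_fun setT (fun zeta => q p zeta * (kernel p zeta * v0 zeta)).
Proof.
move=> [mq _ _]; apply: measurable_funM => //; apply: measurable_funM => //.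
exact: measurable_kernel.
Qed.

Lemma integrable_kint q p : subgaussian q -> 0 < p.2 ->
  (lebesgue_cV R n).-integrable setT
    (fun zeta => (q p zeta * (kernel p zeta * v0 zeta))%:E).
Proof.
move=> sq p0; have [G [G0 iG qG]] := kint_dominated sq p0.
apply: le_integrable iG => //.
  by apply/measurable_EFinP; exact: measurable_kint.
move=> zeta _; rewrite lee_fin (ger0_norm (G0 _)).
by have /nbhs_singleton := qG; apply.
Qed.

Lemma continuous_kint q p : subgaussian q -> 0 < p.2 ->
  {for p, continuous (kint q)}.
Proof.
move=> sq p0; have [G [G0 iG qG]] := kint_dominated sq p0.
apply: (@dominated_cvg_filter _ _ _ (lebesgue_cV R n) _ (nbhs p) _
  (fun k => ball p k.+1%:R^-1) _ _ G) => //.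
- by move=> k; apply: nbhsx_ballx; rewrite invr_gt0.
- move=> A /nbhs_ballP[e /= e0 eA].
  near \oo => N; exists N => k Nk; apply: subset_trans eA.
  apply: le_ball; rewrite (@le_trans _ _ N.+1%:R^-1)//.
    by rewrite lef_pV2 ?posrE// ler_nat ltnS.
  by apply: ltW; near: N; exact: (near_infty_natSinv_lt (PosNum e0)).
- by near=> p'; exact: measurable_kint.
- move=> zeta; case: sq => [_ cq _]; apply: cvgM; first exact: cq.
  by apply: cvgM; [exact: continuous_kernel|exact: cvg_cst].
Unshelve. all: by end_near. Qed.

End kernel.

(** * Differentiation of the integrals *)

(** Differentiation under the integral is applied with a real parameter; this transfers its result
    to directional derivatives on R^n and to the time derivative. *)
Lemma is_derive_line (R : realType) (V : normedModType R) (f : V -> R) (x v : V) df :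
  is_derive (0 : R) 1 (fun h : R => f (h *: v + x)) df -> is_derive x v f df.
Proof.
have E : (fun h : R => h^-1 *:
    (((fun h : R => f (h *: v + x)) \o shift 0) (h *: (1 : R)) -
    f ((0 : R) *: v + x))) = (fun h : R => h^-1 *: ((f \o shift x) (h *: v) - f x)).
  apply/funext => h /=; rewrite scale0r add0r addr0.
  by rewrite /GRing.scale/= mulr1.
case; rewrite /derivable /derive E => df1 df2; exact: DeriveDef.
Qed.

Section factor_derivative.
Context (R : realType).

(** One eigencoordinate of the kernel along an arbitrary curve (Y, tau) with velocity (y, r), so
    that a single computation covers space and time. *)
Lemma is_derive_factor (tau Y : R -> R) (d eta h r y : R) :
  0 <= d -> 0 < tau h -> is_derive h 1 tau r -> is_derive h 1 Y y ->
  is_derive h 1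
    (fun h => Num.sqrt (ccof d (tau h) / pi) *
       expR (- (bcof d (tau h) * (Y h ^+ 2 + eta ^+ 2)
                - 2 * ccof d (tau h) * Y h * eta)))
    ((r * (- (2 * bcof d (tau h))
           + 4 * ccof d (tau h) ^+ 2 * (Y h ^+ 2 + eta ^+ 2)
           - 8 * bcof d (tau h) * ccof d (tau h) * Y h * eta)
      + y * (2 * ccof d (tau h) * eta - 2 * bcof d (tau h) * Y h)) *
     (Num.sqrt (ccof d (tau h) / pi) *
       expR (- (bcof d (tau h) * (Y h ^+ 2 + eta ^+ 2)
                - 2 * ccof d (tau h) * Y h * eta)))).
Proof.
move=> d0 h0 dtau dY.
have db := is_derive1_comp (g := tau) (is_derive_bcof d0 h0) dtau.
have dc := is_derive1_comp (g := tau) (is_derive_ccof d0 h0) dtau.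
have cpi0 : 0 < ccof d (tau h) / pi by rewrite divr_gt0 ?pi_gt0 ?ccof_gt0.
have dsq : is_derive h 1 (fun h => Num.sqrt (ccof d (tau h) / pi))
    (- (2 * bcof d (tau h) * r) * Num.sqrt (ccof d (tau h) / pi)).
  have dcpi := is_derive_fM dc (is_derive_cst (pi : R)^-1 h 1).
  apply: (is_derive_eq (is_derive1_comp
    (g := fun h => ccof d (tau h) / pi) (is_derive1_sqrt cpi0) dcpi)).
  rewrite mulr0 addr0 /cst.
  (* Writing c/pi as the square of its root lets the denominator 2 sqrt(c/pi) cancel; this gives
     (sqrt c)'/sqrt c = - 2 b. *)
  have -> : - (4 * bcof d (tau h) * ccof d (tau h)) * r / pi =
      - (4 * bcof d (tau h)) * r * Num.sqrt (ccof d (tau h) / pi) ^+ 2.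
    by rewrite sqr_sqrtr ?ltW//; ring.
  by field; rewrite gt_eqF// sqrtr_gt0.
have dph : is_derive h 1 (fun h => - (bcof d (tau h) * (Y h ^+ 2 + eta ^+ 2)
    - 2 * ccof d (tau h) * Y h * eta))
   (r * (4 * ccof d (tau h) ^+ 2 * (Y h ^+ 2 + eta ^+ 2)
         - 8 * bcof d (tau h) * ccof d (tau h) * Y h * eta)
    + y * (2 * ccof d (tau h) * eta - 2 * bcof d (tau h) * Y h)).
  have dY2 := is_derive_fD (is_derive_fM dY dY) (is_derive_cst (eta ^+ 2) h 1).
  have d1 := is_derive_fM (is_derive_fM db dY2) (is_derive_cst (- 1 : R) h 1).
  have d2 := is_derive_fM (is_derive_fM dc dY) (is_derive_cst (2 * eta : R) h 1).
  rewrite (_ : (fun h => _) = (fun h => (bcof d (tau h) * (Y h * Y h + eta ^+ 2) * -1)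
    + (ccof d (tau h) * Y h * (2 * eta)))); last first.
    by apply/funext => x; ring.
  apply: (is_derive_eq (is_derive_fD d1 d2)).
  by rewrite /= /cst; ring.
have dexp := is_derive1_comp (g := fun h => - (bcof d (tau h) * (Y h ^+ 2 + eta ^+ 2)
    - 2 * ccof d (tau h) * Y h * eta)) (is_derive_expR _) dph.
by apply: (is_derive_eq (is_derive_fM dsq dexp)); rewrite /=; ring.
Qed.

End factor_derivative.

Section kernel_derivative.
Context (R : realType) (n : nat) (P : 'M[R]_n) (d : 'rV[R]_n).
Hypothesis PP : P *m P^T = 1%:M.
Hypothesis d_ge0 : forall k, 0 <= d ord0 k.
Implicit Types (p : 'cV[R]_n * R) (zeta u : 'cV[R]_n) (r h : R).

Definition line p u r h : 'cV[R]_n * R := (h *: u + p.1, h * r + p.2).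

Lemma line0 p u r : line p u r 0 = p.
Proof. by rewrite /line scale0r mul0r !add0r -surjective_pairing. Qed.

Lemma continuous_line p u r : line p u r h @[h --> 0] --> p.
Proof.
rewrite -[X in _ --> X](line0 p u r).
have c0 : (h : R) @[h --> (0 : R)] --> (0 : R) by [].
have c1 : h *: u + p.1 @[h --> (0 : R)] --> (0 : R) *: u + p.1.
  exact: (cvgD (cvgZr_tmp (a := u) c0) (cvg_cst p.1)).
have c2 : h * r + p.2 @[h --> (0 : R)] --> 0 * r + p.2.
  by apply: cvgD; [exact: cvgMl|exact: cvg_cst].
exact: (cvg_pair c1 c2).
Qed.

Context (v0 : 'cV[R]_n -> R) (K : R).
Hypothesis mv0 : measurable_fun [set: 'cV[R]_n] v0.
Hypothesis v0_bound : forall zeta,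
  `|v0 zeta| <= K * expR (1 / 2 * \sum_k d ord0 k * (P *m zeta) k ord0 ^+ 2).

Local Notation kernel := (kernel P d).
Local Notation kint := (kint P d v0).

(** The derivative is again a [kint] with a subgaussian factor, so the lemma can be applied to its
    own result to reach second derivatives. *)
Lemma is_derive_kint q q' p u r : subgaussian q -> subgaussian q' -> 0 < p.2 ->
  (forall h zeta, 0 < (line p u r h).2 ->
    is_derive h 1 (fun h : R => q (line p u r h) zeta * kernel (line p u r h) zeta)
      (q' (line p u r h) zeta * kernel (line p u r h) zeta)) ->
  is_derive (0 : R) 1 (fun h : R => kint q (line p u r h)) (kint q' p).
Proof.
move=> sq sq' p0 dq.
have [G [G0 iG qG]] := kint_dominated PP d_ge0 v0_bound sq' p0.
have : \forall h \near (0 : R), (forall zeta, `|q' (line p u r h) zeta *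
    (kernel (line p u r h) zeta * v0 zeta)| <= G zeta) /\ 0 < (line p u r h).2.
  have := @continuous_line p u r _ qG => H1.
  have H2 : \forall h \near (0 : R), 0 < (line p u r h).2.
    have : (line p u r h).2 @[h --> 0] --> p.2.
      exact: (cvg_comp _ _ (@continuous_line p u r) (@cvg_snd _ _ _ _ _)).
    by move=> /cvgr_gt; apply.
  by near=> h; split; [move=> zeta; move: zeta; near: h|near: h].
(* On ]-e, e[ the line stays in t > 0 and the differentiated integrand is dominated by the single
   function [G]. *)
move=> /nbhs_ballP[e /= e0 eG].
have eI h : `]- e, e[%classic h -> ball (0 : R) e h.
  by rewrite /ball/= in_itv/= sub0r normrN ltr_norml.
pose f h zeta := q (line p u r h) zeta * (kernel (line p u r h) zeta * v0 zeta).
have df h zeta : `]- e, e[%classic h -> is_derive h 1 (f^~ zeta)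
    (q' (line p u r h) zeta * (kernel (line p u r h) zeta * v0 zeta)).
  move=> /eI /eG[_ h0]; have := is_derive_fM (dq h zeta h0) (is_derive_cst (v0 zeta) h 1).
  rewrite mulr0 addr0 /cst mulrA.
  rewrite (_ : (fun y => _) = f^~ zeta)//; apply/funext => y; by rewrite /f mulrA.
have d1f h zeta : `]- e, e[%classic h -> partial1of2 f h zeta =
    q' (line p u r h) zeta * (kernel (line p u r h) zeta * v0 zeta).
  by move=> /(df h zeta) dh; rewrite partial1of2E; case: dh.
have I0 : `]- e, e[%classic (0 : R) by rewrite /= in_itv/= e0 oppr_lt0 e0.
have H : h^-1 *: (kint q (line p u r (h + 0)) - kint q (line p u r 0)) @[h --> 0^']
    --> kint q' p.
  have -> : kint q' p = \int[lebesgue_cV R n]_zeta (partial1of2 f) 0 zeta.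
    by apply: eq_Rintegral => zeta _; rewrite d1f// line0.
  apply: (@cvg_differentiation_under_integral _ _ _ (lebesgue_cV R n) f setT
    measurableT 0 (- e) e I0 _ _ G G0 iG).
  - move=> h /eI /eG[_ h0]. 
    exact: (integrable_kint PP d_ge0 mv0 v0_bound (p := line p u r h) sq h0).
  - by move=> h zeta Ih _; case: (df h zeta Ih).
  - by move=> h zeta Ih _; rewrite d1f//; have [+ _] := eG _ (eI _ Ih); apply.
have E : (fun h : R => h^-1 *:
    (((fun h => kint q (line p u r h)) \o shift 0) (h *: (1 : R)) -
    kint q (line p u r 0))) =
  (fun h : R => h^-1 *: (kint q (line p u r (h + 0)) - kint q (line p u r 0))).
  by apply/funext => h /=; rewrite /GRing.scale/= mulr1.
apply: DeriveDef; rewrite /derivable /derive E; last exact/cvg_lim.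
by apply/cvg_ex; exists (kint q' p).
Unshelve. all: by end_near. Qed.

(* The logarithmic derivative of the kernel at p = (z, t) in the direction
   (u, r), computed from b' = - 4 c^2, c' = - 4 b c and (sqrt c)' / sqrt c =
   - 2 b. *)
Definition logder u r p zeta : R :=
  \sum_k (r * (- (2 * bcof (d ord0 k) p.2)
               + 4 * ccof (d ord0 k) p.2 ^+ 2 *
                 ((P *m p.1) k ord0 ^+ 2 + (P *m zeta) k ord0 ^+ 2)
               - 8 * bcof (d ord0 k) p.2 * ccof (d ord0 k) p.2 *
                 (P *m p.1) k ord0 * (P *m zeta) k ord0)
          + (P *m u) k ord0 * (2 * ccof (d ord0 k) p.2 * (P *m zeta) k ord0
                               - 2 * bcof (d ord0 k) p.2 * (P *m p.1) k ord0)).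

(** Logarithmic form of the product rule: no products with an omitted factor appear, and no factor
    is divided by, so a list induction suffices. *)
Lemma is_derive_prod (I : Type) (s : seq I) (f : I -> R -> R) (g : I -> R) h :
  (forall i, is_derive h 1 (f i) (g i * f i h)) ->
  is_derive h 1 (fun h => \prod_(i <- s) f i h)
    ((\sum_(i <- s) g i) * \prod_(i <- s) f i h).
Proof.
move=> df; elim: s => [|i s IH].
  rewrite (_ : (fun _ => _) = cst 1); last by apply/funext => x; rewrite big_nil.
  by rewrite !big_nil mul0r; exact: is_derive_cst.
rewrite (_ : (fun _ => _) = fun h => f i h * \prod_(i <- s) f i h); last first.
  by apply/funext => x; rewrite big_cons.
apply: (is_derive_eq (is_derive_fM (df i) IH)); rewrite !big_cons; ring.
Qed.

Lemma is_derive_kernel p u r h zeta : 0 < (line p u r h).2 ->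
  is_derive h 1 (fun h : R => kernel (line p u r h) zeta)
    (logder u r (line p u r h) zeta * kernel (line p u r h) zeta).
Proof.
move=> h0.
pose tau h := (line p u r h).2.
pose Y k h := (P *m (line p u r h).1) k ord0.
pose eta k := (P *m zeta) k ord0.
pose f k h := Num.sqrt (ccof (d ord0 k) (tau h) / pi) *
  expR (- (bcof (d ord0 k) (tau h) * (Y k h ^+ 2 + eta k ^+ 2)
           - 2 * ccof (d ord0 k) (tau h) * Y k h * eta k)).
have kE h' : kernel (line p u r h') zeta = \prod_k f k h'.
  by rewrite /kernel /amplitude /phase -sumrN expR_sum big_split.
have -> : (fun h => kernel (line p u r h) zeta) = (fun h => \prod_k f k h).
  by apply/funext => h'; exact: kE.
rewrite kE; apply: is_derive_prod => k.
have dtau : is_derive h 1 tau r.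
  by apply: is_derive_eq; rewrite /GRing.scale/=; ring.
have dY : is_derive h 1 (Y k) ((P *m u) k ord0).
  have -> : Y k = (fun h => h * (P *m u) k ord0 + (P *m p.1) k ord0).
    by apply/funext => x; rewrite /Y /= mulmxDr -scalemxAr !mxE.
  by apply: is_derive_eq; rewrite /GRing.scale/=; ring.
exact: is_derive_factor.
Qed.

End kernel_derivative.

(** * The initial condition *)

Section initial_condition.
Context (R : realType) (n : nat) (P : 'M[R]_n) (d : 'rV[R]_n).
Hypothesis PP : P *m P^T = 1%:M.
Hypothesis d_ge0 : forall k, 0 <= d ord0 k.
Implicit Types (zeta z w : 'cV[R]_n) (t : R).

Context (v0 : 'cV[R]_n -> R) (K : R).
Hypothesis mv0 : measurable_fun [set: 'cV[R]_n] v0.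
Hypothesis v0_bound : forall zeta,
  `|v0 zeta| <= K * expR (1 / 2 * \sum_k d ord0 k * (P *m zeta) k ord0 ^+ 2).

Local Notation kernel := (kernel P d).

Let j t k := jfun (2 * t * d ord0 k).

Let cvg_id0 : (t : R) @[t --> 0^'+] --> (0 : R).
Proof. exact: cvg_at_right_filter. Qed.

Let cvg_j k : j t k @[t --> 0^'+] --> (1 : R).
Proof.
have c0 : 2 * t * d ord0 k @[t --> 0^'+] --> (0 : R).
  rewrite -[X in _ --> X](mul0r (d ord0 k)) -[X in X * _](mulr0 2).
  by apply: cvgMl; exact: cvgMr.
have j0 : jfun 0 = 1 :> R by rewrite /jfun eqxx.
rewrite -j0; exact: (cvg_comp _ _ c0 (@cvg_jfun R)).
Qed.

(** From (b - c)(b + c) = d^2/4 and b >= c one gets 0 <= b - c <= d^2/(8c). As c = j/(4t), this is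
    (d^2/2) t / j, which tends to 0. *)
Let cvg_bc k : bcof (d ord0 k) t - ccof (d ord0 k) t @[t --> 0^'+] --> (0 : R).
Proof.
apply: (@squeeze_cvgr _ _ _ _ (cst 0) (fun t => d ord0 k ^+ 2 / 2 * (t * (j t k)^-1))).
- near=> t.
  have t0 : 0 < t by near: t; exact: nbhs_right_gt.
  have cb := ccof_le_bcof (d_ge0 k) t0.
  have c0 := ccof_gt0 (d_ge0 k) t0.
  have bs := bcof_sqr (d_ge0 k) t0.
  rewrite subr_ge0 cb /=.
  have -> : (j t k)^-1 = (4 * t * ccof (d ord0 k) t)^-1.
    by rewrite ccofE// [4 * t * _]mulrC divfK// gt_eqF// mulr_gt0.
  rewrite [leRHS](_ : _ = d ord0 k ^+ 2 / 8 / ccof (d ord0 k) t); last first.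
    by field; rewrite !gt_eqF.
  rewrite ler_pdivlMr//.
  set b := bcof _ _ in cb bs *; set c := ccof _ _ in cb c0 bs *; nra.
- exact: cvg_cst.
- rewrite -[X in _ --> X](mulr0 (d ord0 k ^+ 2 / 2)); apply: cvgMr.
  rewrite -[X in _ --> X](mul0r (1^-1 : R)); apply: cvgM => //.
  by apply: cvgV; [exact: oner_neq0|exact: cvg_j].
Unshelve. all: by end_near. Qed.

Let step t := Num.sqrt (4 * t).

Let step_gt0 t : 0 < t -> 0 < step t.
Proof. by move=> t0; rewrite sqrtr_gt0 mulr_gt0. Qed.

Let step2 t : 0 < t -> step t ^+ 2 = 4 * t.
Proof. by move=> t0; rewrite sqr_sqrtr// mulr_ge0// ltW. Qed.

Let cvg_step : step t @[t --> 0^'+] --> (0 : R).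
Proof.
rewrite -[X in _ --> X](sqrtr0 R) -[X in Num.sqrt X](mulr0 4).
apply: (@cvg_comp _ _ _ (fun t : R => 4 * t) (@Num.sqrt R)); last exact: sqrt_continuous.
exact: cvgMr.
Qed.

(* With eta = y + s omega and s^2 = 4t, the exponent b (y^2 + eta^2) - 2 c y eta
   is (b - c) (y^2 + eta^2) + j omega^2, where b - c -> 0 and j -> 1. *)
Lemma rescaled_kernelE z w t : 0 < t ->
  step t ^+ n * kernel (z, t) (z + step t *: w) =
  \prod_k Num.sqrt (j t k / pi) *
  expR (- \sum_k ((bcof (d ord0 k) t - ccof (d ord0 k) t) *
      ((P *m z) k ord0 ^+ 2 + ((P *m z) k ord0 + step t * (P *m w) k ord0) ^+ 2)
    + j t k * (P *m w) k ord0 ^+ 2)).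
Proof.
move=> t0; rewrite /kernel mulrA; congr (_ * _).
  rewrite /amplitude -[n in _ ^+ n]card_ord -prodr_const -big_split/=.
  apply: eq_bigr => k _; rewrite /step -sqrtrM ?mulr_ge0 ?ltW//.
  by rewrite ccofE// mulrA [4 * t * _]mulrC divfK// gt_eqF// mulr_gt0.
congr (expR (- _)); apply: eq_bigr => k _.
have jE : j t k = step t ^+ 2 * ccof (d ord0 k) t.
  by rewrite step2// ccofE// [4 * t * _]mulrC divfK// gt_eqF// mulr_gt0.
rewrite jE /= mulmxDr -scalemxAr !mxE.
ring.
Qed.

Lemma cvg_rescaled_kernel z w :
  step t ^+ n * kernel (z, t) (z + step t *: w) @[t --> 0^'+] -->
  (Num.sqrt pi)^-1 ^+ n * expR (- dotp w w).
Proof.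
pose g t := \prod_k Num.sqrt (j t k / pi) *
  expR (- \sum_k ((bcof (d ord0 k) t - ccof (d ord0 k) t) *
      ((P *m z) k ord0 ^+ 2 + ((P *m z) k ord0 + step t * (P *m w) k ord0) ^+ 2)
    + j t k * (P *m w) k ord0 ^+ 2)).
suff : g t @[t --> 0^'+] --> (Num.sqrt pi)^-1 ^+ n * expR (- dotp w w).
  apply: cvg_trans; apply: near_eq_cvg; near=> t.
  by rewrite rescaled_kernelE//; near: t; exact: nbhs_right_gt.
apply: cvgM.
  rewrite -[X in _ ^+ X]card_ord -prodr_const; apply: cvg_prod => k.
  rewrite -sqrtrV ?pi_ge0// -[X in Num.sqrt X]mul1r.
  apply: (@cvg_comp _ _ _ (fun t : R => j t k / pi) (@Num.sqrt R));
    last exact: sqrt_continuous.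
  by apply: cvgMl; exact: cvg_j.
apply: (@cvg_comp _ _ _ _ expR); last exact: continuous_expR.
apply: cvgN; rewrite (dotp_rot PP); apply: cvg_sum => k.
set y := (P *m z) _ _; set om := (P *m w) _ _.
rewrite -[X in _ --> X](add0r) -[X in X + _](mul0r (y ^+ 2 + (y + 0 * om) ^+ 2)).
rewrite -[X in _ + X]mul1r.
apply: cvgD; apply: cvgM.
- exact: cvg_bc.
- apply: cvgD; first exact: cvg_cst.
  have c1 : y + step t * om @[t --> 0^'+] --> y + 0 * om.
    by apply: cvgD; [exact: cvg_cst|apply: cvgMl; exact: cvg_step].
  exact: (cvgM c1 c1).
- exact: cvg_j.
- exact: cvg_cst.
Unshelve. all: by end_near. Qed.

(** For small t, j >= 3/4 gives decay 3/4 omega^2, and the (b - c) term only helps. The data cost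
    (d/2)(y + s omega)^2 <= d y^2 + 4td omega^2, with 4td <= 1/4. The net decay is 3/4 - 1/4 = 1/2;
    j <= 2 bounds the prefactor. *)
Lemma rescaled_kernel_bound z : exists C, \forall t \near 0^'+, forall w,
  `|step t ^+ n * kernel (z, t) (z + step t *: w) * v0 (z + step t *: w)| <=
  C * expR (- (1 / 2 * dotp w w)).
Proof.
exists (\prod_(k < n) Num.sqrt (2 / pi) * K *
  expR (\sum_k d ord0 k * (P *m z) k ord0 ^+ 2)).
near=> t => w.
have t0 : 0 < t by near: t; exact: nbhs_right_gt.
have j_ge k : 3 / 4 <= j t k.
  move: k; near: t; apply: filter_forall => k.
  by apply: (cvgr_ge _ (cvg_j k)); lra.
have j_le k : j t k <= 2.
  move: k; near: t; apply: filter_forall => k.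
  by apply: (cvgr_le _ (cvg_j k)); lra.
have td k : 4 * t * d ord0 k <= 1 / 4.
  move: k; near: t; apply: filter_forall => k.
  have c0 : 4 * t * d ord0 k @[t --> 0^'+] --> (0 : R).
    rewrite -[X in _ --> X](mul0r (d ord0 k)) -[X in X * _](mulr0 4).
    by apply: cvgMl; exact: cvgMr.
  by apply: (cvgr_le _ c0); lra.
rewrite rescaled_kernelE// normrM normrM (ger0_norm (expR_ge0 _)).
rewrite ger0_norm; last by apply: prodr_ge0 => k _; exact: sqrtr_ge0.
set A := \prod_k _; set E := expR _.
apply: (@le_trans _ _ (A * E * (K * expR (1 / 2 *
    \sum_k d ord0 k * (P *m (z + step t *: w)) k ord0 ^+ 2)))).
  by rewrite ler_wpM2l// mulr_ge0 ?expR_ge0// prodr_ge0// => k _; exact: sqrtr_ge0.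
rewrite mulrACA -expRD.
rewrite [leRHS](_ : _ = (\prod_(k < n) Num.sqrt (2 / pi) * K) *
  (expR (\sum_k d ord0 k * (P *m z) k ord0 ^+ 2) *
   expR (- (1 / 2 * dotp w w)))); last by ring.
have K0 := growth_constant_ge0 v0_bound.
rewrite -expRD ler_pM ?expR_ge0//.
- by rewrite mulr_ge0// prodr_ge0// => k _; exact: sqrtr_ge0.
- rewrite ler_wpM2r//; apply: ler_prod => k _; rewrite sqrtr_ge0/=.
  by rewrite ler_wsqrtr// ler_pM2r ?invr_gt0 ?pi_gt0.
rewrite ler_expR (dotp_rot PP) !mulr_sumr -!sumrN -!big_split/=.
apply: ler_sum => k _.
have -> : (P *m (z + step t *: w)) k ord0 =
    (P *m z) k ord0 + step t * (P *m w) k ord0.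
  by rewrite mulmxDr -scalemxAr !mxE.
have bc0 := ccof_le_bcof (d_ge0 k) t0.
have s2 := step2 t0.
have := j_ge k; have := td k; have := d_ge0 k.
set y := (P *m z) _ _; set om := (P *m w) _ _.
set dk := d ord0 k in bc0 *; set jk := j t k; set s := step t in s2 *.
set bc := bcof dk t - ccof dk t in bc0 *.
move=> dk0 dkt jk0.
have h1 : 0 <= bc * (y ^+ 2 + (y + s * om) ^+ 2).
  by apply: mulr_ge0; rewrite ?subr_ge0//; apply: addr_ge0; exact: sqr_ge0.
have h2 : 3 / 4 * om ^+ 2 <= jk * om ^+ 2 by rewrite ler_wpM2r ?sqr_ge0.
have h3 : 1 / 2 * (dk * (y + s * om) ^+ 2) <= dk * y ^+ 2 + 4 * t * dk * om ^+ 2.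
  have : 0 <= dk * (y - s * om) ^+ 2 by rewrite mulr_ge0 ?sqr_ge0.
  by rewrite -s2; nra.
have h4 : 4 * t * dk * om ^+ 2 <= 1 / 4 * om ^+ 2 by rewrite ler_wpM2r ?sqr_ge0.
lra.
Unshelve. all: by end_near. Qed.

Hypothesis v0_cont : continuous v0.

Lemma cvg_kernel_integral z :
  \int[lebesgue_cV R n]_zeta (kernel (z, t) zeta * v0 zeta) @[t --> 0^'+] --> v0 z.
Proof.
have gauss1 : (lebesgue_cV R n).-integrable setT
    (EFin \o (fun w : 'cV[R]_n => expR (- dotp w w))).
  apply: eq_integrable (integrable_gauss_cV n (ltr01 : 0 < 1 :> R)) => // w _.
  by rewrite /= mul1r.
(* The limit is written as a Gaussian average of the constant v0 z, so that both sides are integrals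
   over w and dominated convergence applies. *)
have -> : v0 z = \int[lebesgue_cV R n]_w
    ((Num.sqrt pi)^-1 ^+ n * expR (- dotp w w) * v0 z).
  under eq_Rintegral do rewrite mulrAC.
  rewrite RintegralZl// /Rintegral.
  have -> : (\int[lebesgue_cV R n]_w (expR (- dotp w w))%:E =
      ((Num.sqrt pi) ^+ n)%:E)%E.
    rewrite -[Num.sqrt pi]divr1 -[X in _ / X]sqrtr1 -integral_gauss_cV//.
    by apply: eq_integral => w _; rewrite mul1r.
  rewrite /= mulrAC -exprMn mulVf ?expr1n ?mul1r//.
  by rewrite gt_eqF// sqrtr_gt0 pi_gt0.
pose f t w := step t ^+ n * kernel (z, t) (z + step t *: w) * v0 (z + step t *: w).
have mf t : measurable_fun [set: 'cV[R]_n] (f t).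
  apply: measurable_funM.
    apply: measurable_funM => //.
    exact: (measurableT_comp (measurable_kernel P d (z, t))
      (measurable_affine_cV z (step t))).
  exact: (measurableT_comp mv0 (measurable_affine_cV z (step t))).
have [C fC] := rescaled_kernel_bound z.
have intG : (lebesgue_cV R n).-integrable setT
    (EFin \o (fun w : 'cV[R]_n => C * expR (- (1 / 2 * dotp w w)))).
  rewrite (_ : _ \o _ = fun w => (C%:E * (expR (- (1 / 2 * dotp w w)))%:E)%E)//.
  by apply: integrableZl => //; apply: integrable_gauss_cV; rewrite divr_gt0.
suff : \int[lebesgue_cV R n]_w f t w @[t --> 0^'+] -->
    \int[lebesgue_cV R n]_w ((Num.sqrt pi)^-1 ^+ n * expR (- dotp w w) * v0 z).
  apply: cvg_trans; apply: near_eq_cvg; near=> t.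
  have t0 : 0 < t by near: t; exact: nbhs_right_gt.
  have intf : (lebesgue_cV R n).-integrable setT (EFin \o f t).
    apply: le_integrable intG => //; first exact/measurable_EFinP.
    move=> w _; rewrite lee_fin (le_trans _ (ler_norm _))//.
    by move: w; near: t.
  have intk : (lebesgue_cV R n).-integrable setT
      (EFin \o (fun zeta => kernel (z, t) zeta * v0 zeta)).
    apply: eq_integrable (integrable_kint PP d_ge0 mv0 v0_bound (p := (z, t))
      (subgaussian_cst n 1) t0) => // zeta _.
    by rewrite /= mul1r.
  have sn0 : step t ^+ n != 0 by rewrite expf_neq0// gt_eqF// step_gt0.
  rewrite -(integral_affine_cV z (step_gt0 t0) intk).
  rewrite (_ : \int[_]_w (_ * _) = \int[lebesgue_cV R n]_w ((step t ^+ n)^-1 * f t w)).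
    by rewrite RintegralZl// mulrA divff// mul1r.
  by apply: eq_Rintegral => w _; rewrite /f -mulrA mulKf.
(* The intervals 0 < t < 1/(k+1) form a countable base of the right neighbourhoods of 0. *)
apply: (@dominated_cvg_filter _ _ _ (lebesgue_cV R n) _ _ _
  (fun k => [set t : R | 0 < t < k.+1%:R^-1]) _ _
  (fun w => C * expR (- (1 / 2 * dotp w w)))) => //.
- move=> k; near=> t; apply/andP; split; near: t.
    exact: nbhs_right_gt.
  by apply: nbhs_right_lt; rewrite invr_gt0.
- move=> A [e /= e0 eA].
  near \oo => N; exists N => k Nk t /andP[t0 tk]; apply: eA => //=.
  rewrite sub0r normrN gtr0_norm// (lt_le_trans tk)//.
  rewrite (@le_trans _ _ N.+1%:R^-1)//.
    by rewrite lef_pV2 ?posrE// ler_nat ltnS.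
  by apply: ltW; near: N; exact: (near_infty_natSinv_lt (PosNum e0)).
- by near=> t; exact: mf.
- move=> w; apply: cvgM; first exact: cvg_rescaled_kernel.
  have czw : z + step t *: w @[t --> 0^'+] --> z.
    rewrite -[X in _ --> X]addr0 -[X in _ + X](scale0r w).
    by apply: cvgD; [exact: cvg_cst|exact: (cvgZr_tmp cvg_step)].
  exact: (cvg_comp _ _ czw (@v0_cont z)).
Unshelve. all: by end_near. Qed.

End initial_condition.

(** * The equation *)

Section solution.
Context (R : realType) (n : nat) (P : 'M[R]_n) (d : 'rV[R]_n).
Hypothesis PP : P *m P^T = 1%:M.
Hypothesis d_ge0 : forall k, 0 <= d ord0 k.
Implicit Types (p : 'cV[R]_n * R) (zeta z u w : 'cV[R]_n) (r h t : R).

Context (v0 : 'cV[R]_n -> R) (K : R).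
Hypothesis mv0 : measurable_fun [set: 'cV[R]_n] v0.
Hypothesis v0_bound : forall zeta,
  `|v0 zeta| <= K * expR (1 / 2 * \sum_k d ord0 k * (P *m zeta) k ord0 ^+ 2).

Local Notation kernel := (kernel P d).
Local Notation kint := (kint P d v0).
Local Notation logder := (logder P d).
Let D := P^T *m diag_mx d *m P.
Let v := mehler_integral D v0.

(** The Hessian in z of the logarithm of the kernel, evaluated on u and w. Since the phase is
    quadratic in z, it depends on t alone. *)
Definition hesslog u w p : R :=
  - \sum_k 2 * bcof (d ord0 k) p.2 * (P *m u) k ord0 * (P *m w) k ord0.

Lemma subgaussian_logder u r : subgaussian (logder u r).
Proof.
have sc a := subgaussian_cst n a.
apply: subgaussian_sum => k.
have sb : subgaussian (fun p (_ : 'cV[R]_n) => bcof (d ord0 k) p.2).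
  by apply: subgaussian_param => p p0; exact: continuous_bcof.
have scc : subgaussian (fun p (_ : 'cV[R]_n) => ccof (d ord0 k) p.2).
  by apply: subgaussian_param => p p0; exact: continuous_ccof.
have sY : subgaussian (fun p (_ : 'cV[R]_n) => (P *m p.1) k ord0).
  by apply: subgaussian_param => p p0; exact: continuous_mulmx_coord.
have se := subgaussian_mulmx P k.
(* Squares become products and differences become sums with negative constants, so that the closure
   lemmas match syntactically. *)
rewrite (_ : (fun p zeta => _) = fun p zeta =>
   r * ((- 2) * bcof (d ord0 k) p.2 +
     4 * (ccof (d ord0 k) p.2 * ccof (d ord0 k) p.2) *
       ((P *m p.1) k ord0 * (P *m p.1) k ord0 +
        (P *m zeta) k ord0 * (P *m zeta) k ord0) +
     (- 8) * bcof (d ord0 k) p.2 * ccof (d ord0 k) p.2 *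
       (P *m p.1) k ord0 * (P *m zeta) k ord0) +
   (P *m u) k ord0 * (2 * ccof (d ord0 k) p.2 * (P *m zeta) k ord0 +
     (- 2) * bcof (d ord0 k) p.2 * (P *m p.1) k ord0)); last first.
  by apply/funext => p; apply/funext => zeta; ring.
by repeat first [exact: sb|exact: scc|exact: sY|exact: se|exact: sc
  |apply: subgaussianD|apply: subgaussianM].
Qed.

(** The factor is the second derivative of the kernel along u and w divided by the kernel: L_u L_w +
    H(u, w), with L the gradient and H the Hessian of its logarithm. *)
Lemma subgaussian_hess u w :
  subgaussian (fun p zeta => logder u 0 p zeta * logder w 0 p zeta + hesslog u w p).
Proof.
apply: subgaussianD.
  by apply: subgaussianM; exact: subgaussian_logder.
apply: subgaussian_param => p p0; apply: cvgN; apply: cvg_sum => k.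
by apply: cvgMl; apply: cvgMl; apply: cvgMr; exact: continuous_bcof.
Qed.

Lemma is_derive_logder p u w h zeta :
  is_derive h 1 (fun h : R => logder u 0 (line p w 0 h) zeta)
    (hesslog u w (line p w 0 h)).
Proof.
pose b k := bcof (d ord0 k) p.2.
pose A := \sum_k (P *m u) k ord0 * (2 * ccof (d ord0 k) p.2 * (P *m zeta) k ord0
  - 2 * b k * (P *m p.1) k ord0).
have -> : (fun h : R => logder u 0 (line p w 0 h) zeta) =
    (fun h => A + h * hesslog u w p).
  apply/funext => x; rewrite /logder /hesslog /A -sumrN mulr_sumr.
  rewrite -big_split/=; apply: eq_bigr => k _.
  rewrite /line/= mulr0 add0r mulmxDr -scalemxAr /b.
  have -> : (x *: (P *m w) + P *m p.1) k ord0 = x * (P *m w) k ord0 + (P *m p.1) k ord0.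
    by rewrite !mxE.
  by ring.
rewrite (_ : hesslog u w (line p w 0 h) = hesslog u w p); last first.
  by rewrite /hesslog /line/= mulr0 add0r.
by apply: is_derive_eq; rewrite /GRing.scale/=; ring.
Qed.

Lemma is_derive_kint1 p u r : 0 < p.2 ->
  is_derive (0 : R) 1 (fun h : R => kint (fun _ _ => 1) (line p u r h))
    (kint (logder u r) p).
Proof.
move=> p0; apply: (is_derive_kint PP d_ge0 mv0 v0_bound) => //.
- exact: subgaussian_cst.
- exact: subgaussian_logder.
- move=> h zeta h0; rewrite (_ : (fun h => _) = fun h => kernel (line p u r h) zeta).
    exact: is_derive_kernel.
  by apply/funext => x; rewrite mul1r.
Qed.

Lemma is_derive_kint2 p u w : 0 < p.2 ->
  is_derive (0 : R) 1 (fun h : R => kint (logder u 0) (line p w 0 h))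
    (kint (fun p zeta => logder u 0 p zeta * logder w 0 p zeta + hesslog u w p) p).
Proof.
move=> p0; apply: (is_derive_kint PP d_ge0 mv0 v0_bound) => //.
- exact: subgaussian_logder.
- exact: subgaussian_hess.
- move=> h zeta h0.
  have H := is_derive_fM (is_derive_logder p u w h zeta)
    (is_derive_kernel P (p := p) (u := w) (r := 0) (h := h) d_ge0 zeta h0).
  apply: (is_derive_eq H).
  by ring.
Qed.

Lemma mehler_integralE z t : 0 < t -> v z t = kint (fun _ _ => 1) (z, t).
Proof.
move=> t0; apply: eq_Rintegral => zeta _.
by rewrite mul1r /D (mehlerE PP d_ge0).
Qed.

Lemma is_derive_time z t : 0 < t -> is_derive t 1 (v z) (kint (logder 0 1) (z, t)).
Proof.
(* [mehler] agrees with the kernel only for t > 0, so in the time variable the two functions agree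
   only near t. In the space derivatives t is fixed and the functions are equal. *)
move=> t0; apply: (@near_eq_is_derive _ _ _ (fun t => kint (fun _ _ => 1) (z, t))).
  near=> s; rewrite mehler_integralE//; near: s; exact: (lt_nbhsr t0).
apply: is_derive_line.
rewrite (_ : (fun h => _) = fun h => kint (fun _ _ => 1) (line (z, t) 0 1 h)).
  exact: is_derive_kint1.
by apply/funext => h; rewrite /line/= scaler0 add0r.
Unshelve. all: by end_near. Qed.

Lemma is_derive_space z u t : 0 < t ->
  is_derive z u (v^~ t) (kint (logder u 0) (z, t)).
Proof.
move=> t0; rewrite (_ : v^~ t = fun z => kint (fun _ _ => 1) (z, t)); last first.
  by apply/funext => x; exact: mehler_integralE.
apply: is_derive_line.
rewrite (_ : (fun h => _) = fun h => kint (fun _ _ => 1) (line (z, t) u 0 h)).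
  exact: is_derive_kint1.
by apply/funext => h; rewrite /line/= mulr0 add0r.
Qed.

Lemma partial_mehler i z t : 0 < t ->
  partial i (v^~ t) z = kint (logder (delta_mx i ord0) 0) (z, t).
Proof. by move=> /(is_derive_space z (delta_mx i ord0)) []. Qed.

Lemma is_derive_partial i u z t : 0 < t ->
  is_derive z u (partial i (v^~ t))
    (kint (fun p zeta => logder (delta_mx i ord0) 0 p zeta * logder u 0 p zeta
                         + hesslog (delta_mx i ord0) u p) (z, t)).
Proof.
move=> t0; rewrite (_ : partial i (v^~ t) =
    fun z => kint (logder (delta_mx i ord0) 0) (z, t)); last first.
  by apply/funext => x; exact: partial_mehler.
apply: is_derive_line.
rewrite (_ : (fun h => _) =
    fun h => kint (logder (delta_mx i ord0) 0) (line (z, t) u 0 h)).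
  exact: is_derive_kint2.
by apply/funext => h; rewrite /line/= mulr0 add0r.
Qed.

Lemma continuous_half_space_kint (g : 'cV[R]_n -> R -> R) q : subgaussian q ->
  (forall z t, 0 < t -> g z t = kint q (z, t)) -> continuous_half_space g.
Proof.
move=> sq gE p p0; have gkint p' : 0 < p'.2 -> g p'.1 p'.2 = kint q p'.
  by move=> p'0; rewrite (gE p'.1 p'.2 p'0) -surjective_pairing.
suff : g p'.1 p'.2 @[p' --> p] --> kint q p by rewrite -(gkint p p0).
apply: cvg_trans (continuous_kint PP d_ge0 mv0 v0_bound sq p0).
apply: near_eq_cvg; near=> p'.
have p'0 : 0 < p'.2; last by rewrite (gkint p' p'0).
near: p'; have : (p' : 'cV[R]_n * R).2 @[p' --> p] --> p.2 by exact: cvg_snd.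
by move=> /cvgr_gt; apply.
Unshelve. all: by end_near. Qed.

Lemma class_C21_mehler : class_C21 v.
Proof.
split.
- move=> z t t0; split.
  + by case: (is_derive_time z t0).
  + by move=> i; case: (is_derive_space z (delta_mx i ord0) t0).
  + by move=> i j; case: (is_derive_partial i (delta_mx j ord0) z t0).
- exact: (continuous_half_space_kint (subgaussian_cst n 1) mehler_integralE).
- apply: (continuous_half_space_kint (subgaussian_logder 0 1)) => z t t0.
  by case: (is_derive_time z t0).
- move=> i; apply: (continuous_half_space_kint (subgaussian_logder _ 0)) => z t t0.
  exact: partial_mehler.
- move=> i j; apply: (continuous_half_space_kint
    (subgaussian_hess (delta_mx i ord0) (delta_mx j ord0))) => z t t0.
  exact: (@derive_val _ _ _ _ _ _ _ (is_derive_partial i (delta_mx j ord0) z t0)).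
Qed.

Lemma kintB q1 q2 p : subgaussian q1 -> subgaussian q2 -> 0 < p.2 ->
  kint (fun p zeta => q1 p zeta - q2 p zeta) p = kint q1 p - kint q2 p.
Proof.
move=> s1 s2 p0; rewrite /kint -RintegralB//.
- by apply: eq_Rintegral => zeta _; rewrite mulrBl.
- exact: (integrable_kint PP d_ge0 mv0 v0_bound s1 p0).
- exact: (integrable_kint PP d_ge0 mv0 v0_bound s2 p0).
Qed.

Lemma kint_sum (I : Type) (s : seq I) q p : (forall i, subgaussian (q i)) -> 0 < p.2 ->
  kint (fun p zeta => \sum_(i <- s) q i p zeta) p = \sum_(i <- s) kint (q i) p.
Proof.
move=> sq p0; elim: s => [|i s IH].
  rewrite big_nil /kint; under eq_Rintegral do rewrite big_nil mul0r.
  by rewrite Rintegral_cst// mul0r.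
rewrite big_cons -IH /kint -RintegralD//.
- by apply: eq_Rintegral => zeta _; rewrite big_cons mulrDl.
- exact: (integrable_kint PP d_ge0 mv0 v0_bound (sq i) p0).
- exact: (integrable_kint PP d_ge0 mv0 v0_bound (subgaussian_sum s sq) p0).
Qed.

(** The equation divided by the kernel. The logarithmic gradient in z is P^T g with g_k = 2 c eta -
    2 b y, so orthogonality gives |g|^2 for its square and - 2 sum b_k for the trace of the Hessian.
    Everything then splits over k, and each term reduces to (4 b^2 - 4 c^2 - d_k^2) y^2 = 0. *)
Lemma kernel_pde z zeta t : 0 < t ->
  \sum_i (logder (delta_mx i ord0) 0 (z, t) zeta * logder (delta_mx i ord0) 0 (z, t) zeta
          + hesslog (delta_mx i ord0) (delta_mx i ord0) (z, t))
  - dotp (D *m z) (D *m z) - logder 0 1 (z, t) zeta = 0.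
Proof.
move=> t0.
pose b k := bcof (d ord0 k) t; pose c k := ccof (d ord0 k) t.
pose y k := (P *m z) k ord0; pose eta k := (P *m zeta) k ord0.
pose g : 'cV[R]_n := \col_k (2 * c k * eta k - 2 * b k * y k).
have Pe i k : (P *m delta_mx i ord0) k ord0 = P k i.
  rewrite mxE (bigD1 i)//= big1 => [|l li]; rewrite !mxE ?(negPf li) ?mulr0//.
  by rewrite !eqxx mulr1 addr0.
have gE i : logder (delta_mx i ord0) 0 (z, t) zeta = (P^T *m g) i ord0.
  rewrite /logder mxE; apply: eq_bigr => k _.
  by rewrite mul0r add0r Pe [P^T _ _]mxE [g _ _]mxE.
have E1 : \sum_i logder (delta_mx i ord0) 0 (z, t) zeta *
    logder (delta_mx i ord0) 0 (z, t) zeta = \sum_k g k ord0 ^+ 2.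
  under eq_bigr do rewrite gE.
  rewrite -/(dotp _ _) (dotp_rot PP) mulmxA PP mul1mx.
  by apply: eq_bigr => k _; rewrite expr2.
have E2 : \sum_i hesslog (delta_mx i ord0) (delta_mx i ord0) (z, t) =
    - \sum_k 2 * b k.
  rewrite /hesslog sumrN exchange_big/=; congr (- _); apply: eq_bigr => k _.
  under eq_bigr do rewrite !Pe -mulrA.
  rewrite -mulr_sumr (_ : \sum_i _ = (P *m P^T) k k).
    by rewrite PP mxE eqxx mulr1.
  by rewrite mxE; apply: eq_bigr => i _; rewrite mxE.
have E3 : dotp (D *m z) (D *m z) = \sum_k d ord0 k ^+ 2 * y k ^+ 2.
  rewrite {1}/D dotp_orthodiag; apply: eq_bigr => k _.
  rewrite /D !mulmxA PP mul1mx -mulmxA mul_diag_mx mxE -/(y k); ring.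
rewrite big_split/= E1 E2 E3 /logder -sumrN -big_split/= -sumrB -sumrB.
apply: big1 => k _.
have -> : (P *m (0 : 'cV[R]_n)) k ord0 = 0 by rewrite mulmx0 mxE.
rewrite [g _ _]mxE mul0r addr0 mul1r -/(b k) -/(c k).
have := bcof_sqr (d_ge0 k) t0; rewrite -/(b k) -/(c k) => E.
have -> : d ord0 k ^+ 2 = 4 * b k ^+ 2 - 4 * c k ^+ 2 by rewrite E; field.
by rewrite -/(y k) -/(eta k); ring.
Qed.

Lemma mehler_pde z t : 0 < t ->
  laplacian (v^~ t) z - dotp (D *m z) (D *m z) * v z t - 'D_1 (v z) t = 0.
Proof.
move=> t0; set C := dotp _ _.
have -> : 'D_1 (v z) t = kint (logder 0 1) (z, t) by case: (is_derive_time z t0).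
have -> : laplacian (v^~ t) z = kint (fun p zeta => \sum_i
    (logder (delta_mx i ord0) 0 p zeta * logder (delta_mx i ord0) 0 p zeta
     + hesslog (delta_mx i ord0) (delta_mx i ord0) p)) (z, t).
  rewrite kint_sum//; last by move=> i; exact: subgaussian_hess.
  by apply: eq_bigr => i _; case: (is_derive_partial i (delta_mx i ord0) z t0).
have -> : C * v z t = kint (fun _ _ => C) (z, t).
  rewrite mehler_integralE// /kint -RintegralZl//.
    by apply: eq_Rintegral => zeta _; rewrite mul1r.
  exact: (integrable_kint PP d_ge0 mv0 v0_bound (p := (z, t)) (subgaussian_cst n 1) t0).
have sS := subgaussian_sum (index_enum 'I_n)
  (fun i => subgaussian_hess (delta_mx i ord0) (delta_mx i ord0)).
have sC := subgaussian_cst n C.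
have sB : subgaussian (fun p zeta => \sum_i
    (logder (delta_mx i ord0) 0 p zeta * logder (delta_mx i ord0) 0 p zeta
     + hesslog (delta_mx i ord0) (delta_mx i ord0) p) - C).
  by apply: subgaussianD => //; exact: subgaussian_cst.
(* The three integrals merge into one whose integrand vanishes pointwise by [kernel_pde]. *)
rewrite -kintB// -kintB//; last exact: subgaussian_logder.
rewrite /kint; under eq_Rintegral do rewrite kernel_pde// mul0r.
by rewrite Rintegral_cst// mul0r.
Qed.

End solution.

Theorem proposition3p2 (R : realType) (n : nat) (D : 'M[R]_n)
  (D_sym : D^T = D) (D_ge0 : nonneg_definite D)
  (v0 : 'cV[R]_n -> R) (v0_cont : continuous v0)
  (v0_Loo : (fun z => expR (- (1 / 2) * dotp (D *m z) z) * v0 z)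
              \in Lfun (lebesgue_cV R n) +oo%E) :
  (forall z t, 0 < t ->
     (lebesgue_cV R n).-integrable setT
       (fun zeta => (mehler D z zeta t * v0 zeta)%:E)) /\
  classical_solution D v0 (mehler_integral D v0).
Proof.
have [P [d [PP DE]]] := symmetric_orthodiag D_sym; subst D.
have d_ge0 := orthodiag_ge0 PP D_ge0.
pose Q (zeta : 'cV[R]_n) := \sum_k d ord0 k * (P *m zeta) k ord0 ^+ 2.
have QE zeta : dotp (P^T *m diag_mx d *m P *m zeta) zeta = Q zeta.
  by rewrite dotp_orthodiag; apply: eq_bigr => k _; rewrite -mulrA expr2.
have v0E zeta : v0 zeta = expR (1 / 2 * Q zeta) *
    (expR (- (1 / 2) * dotp (P^T *m diag_mx d *m P *m zeta) zeta) * v0 zeta).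
  by rewrite mulrA QE -expRD mulNr subrr expR0 mul1r.
have cQ : continuous Q.
  move=> z; apply: (@cvg_sum _ _ _ (nbhs z)) => k; apply: cvgMr.
  have cY := @continuous_mulmx R n P k z.
  exact: (cvgM cY cY).
have [K Kv0] : exists K : R, forall zeta,
    `|expR (- (1 / 2) * dotp (P^T *m diag_mx d *m P *m zeta) zeta) * v0 zeta| <= K.
  have cE : continuous (fun z => expR (- (1 / 2) * Q z)).
    move=> z; have c1 : - (1 / 2) * Q x @[x --> z] --> - (1 / 2) * Q z.
      exact: (cvgM (cvg_cst _) (@cQ z)).
    exact: (cvg_comp _ _ c1 (@continuous_expR R _)).
  apply: continuous_Loo_bounded v0_Loo.
  under eq_fun do rewrite QE.
  by move=> z; exact: (cvgM (@cE z) (@v0_cont z)).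
have v0_bound zeta : `|v0 zeta| <= K * expR (1 / 2 * Q zeta).
  by rewrite v0E normrM ger0_norm ?expR_ge0// mulrC ler_wpM2r ?expR_ge0.
(* Membership in [Lfun] supplies measurability of the weighted data; multiplying by the measurable
   inverse weight recovers [v0]. *)
have mv0 : measurable_fun setT v0.
  rewrite (funext v0E); apply: measurable_funM.
    apply: measurableT_comp => //; apply: measurable_funM => //.
    apply: measurable_sum => k; apply: measurable_funM => //.
    by apply: measurable_funX; exact: measurable_mulmx_coord.
  by move: v0_Loo => /andP[/[!inE]].
split.
- move=> z t t0; apply: eq_integrable (integrable_kint PP d_ge0 mv0 v0_bound (p := (z, t))
    (subgaussian_cst n 1) t0) => // zeta _.
  by rewrite mul1r (mehlerE PP d_ge0).
- split.
  + exact: class_C21_mehler mv0 v0_bound.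
  + exact: mehler_pde mv0 v0_bound.
  + move=> z; have H := @cvg_kernel_integral _ _ _ _ PP d_ge0 _ _ mv0 v0_bound v0_cont z.
    apply: cvg_trans H.
    apply: near_eq_cvg; near=> t; apply: eq_Rintegral => zeta _.
    by rewrite (mehlerE PP d_ge0)//; near: t; exact: nbhs_right_gt.
Unshelve. all: by end_near. Qed.
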